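(* Let $X$ be a compact metric space and let $f:X\to X$ be a continuous map with the exponential specification property. Let $A:X\to GL(m,\mathbb{R})$ be an $\alpha$-H\''older continuous function for some $\alpha>0$. Suppose that $$\inf_{\mu\in\mathcal{M}^e_f(X)}\chi_{max}(A,\mu)<\sup_{\mu\in\mathcal{M}^e_f(X)}\chi_{max}(A,\mu).$$ Then the Max-Lyapunov-irregular set $MLI(A,f)$ contains an uncountable DC1-scrambled set.
   Context: Cocycle: for $n>0$, $A(x,n):=A(f^{n-1}x)\cdots A(fx)A(x)$. $\mathcal{M}^e_f(X)$ denotes the set of ergodic $f$-invariant Borel probability measures on $X$. For $x\in X$, the maximal Lyapunov exponent is $\chi_{max}(A,x)=\lim_{n\to\infty}\frac1n\log\|A(x,n)\|$ when the limit exists; $x$ is then Max-Lyapunov-regular, and otherwise Max-Lyapunov-irregular. $MLI(A,f)$ is the set of Max-Lyapunov-irregular points. For $\mu\in\mathcal{M}^e_f(X)$, $\chi_{max}(A,\mu)$ is the constant value of $\chi_{max}(A,x)$ for $\mu$-a.e. $x$ (which exists by Kingman's subadditive ergodic theorem). Exponential specification: for $x\in X$, $\delta>0$, $\lambda>0$, $n\ge 0$, let $B_n(x,\delta,\lambda)=\{y\in X: d(f^ix,f^iy)<\delta e^{-\lambda\min\{i,n-i\}} \text{ for all } 0\le i\le n\}$. The map $f$ has the exponential specification property (with some exponent $\lambda>0$ depending only on $f$) if for every $\delta>0$ there is a positive integer $N=N(\delta)$ such that for every $k\ge1$, all points $x_1,\dots,x_k\in X$ and all nonnegative integer sequences $\{N_i\}_{i=1}^k,\{M_i\}_{i=1}^k$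 with $N_1=0$ and $N_j\ge N_{j-1}+M_{j-1}+N$ for $2\le j\le k$, the set $\bigcap_{i=1}^k f^{-N_i}B_{M_i}(x_i,\delta,\lambda)$ is nonempty. DC1: a pair $x,y\in X$ is DC1-scrambled if for every $t>0$, $\limsup_{n\to\infty}\frac1n|\{i\in[0,n-1]: d(f^ix,f^iy)<t\}|=1$, and there exists $t_0>0$ with $\liminf_{n\to\infty}\frac1n|\{i\in[0,n-1]: d(f^ix,f^iy)<t_0\}|=0$. A set $S\subseteq X$ is DC1-scrambled if every pair of distinct points of $S$ is DC1-scrambled. *)

(* Defs.v *)
From HB Require Import structures.
From mathcomp Require Import all_boot all_order all_algebra.
From mathcomp Require Import all_classical all_reals all_analysis.
Set Implicit Arguments. Unset Strict Implicit. Unset Printing Implicit Defensive.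
Import Order.TTheory GRing.Theory Num.Theory.
Import numFieldNormedType.Exports.
Local Open Scope classical_set_scope.
Local Open Scope ring_scope.

Section Defs.
Variables (R : realType) (X : pointedType).

Definition is_metric (d : X -> X -> R) : Prop :=
  [/\ forall x y, 0 <= d x y,
      forall x y, d x y = 0 <-> x = y,
      forall x y, d x y = d y x &
      forall x y z, d x z <= d x y + d y z].

Definition mopen (d : X -> X -> R) (U : set X) : Prop :=
  forall x, U x -> exists2 r : R, 0 < r & forall y, d x y < r -> U y.

Definition mcompact (d : X -> X -> R) : Prop :=
  forall C : set (set X), C `<=` mopen d -> setT `<=` \bigcup_(U in C) U ->
  exists F : set (set X),
    [/\ F `<=` C, finite_set F & setT `<=` \bigcup_(U in F) U].

Definition mcontinuous (d : X -> X -> R) (f : X -> X) : Prop :=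
  forall x (e : R), 0 < e -> exists2 del : R, 0 < del &
    forall y, d x y < del -> d (f x) (f y) < e.

Definition bowen_ball (d : X -> X -> R) (f : X -> X) (x : X)
  (delta lambda : R) (n : nat) : set X :=
  [set y | forall i, (i <= n)%N ->
     d (iter i f x) (iter i f y) < delta * expR (- lambda * (minn i (n - i))%:R)].

Definition exp_specification (d : X -> X -> R) (f : X -> X) : Prop :=
  exists2 lambda : R, 0 < lambda &
  forall delta : R, 0 < delta -> exists2 N : nat, (0 < N)%N &
  forall (k : nat) (xs : nat -> X) (Ns Ms : nat -> nat),
    (1 <= k)%N -> Ns 0%N = 0%N ->
    (forall j, (1 <= j < k)%N -> (Ns j >= Ns j.-1 + Ms j.-1 + N)%N) ->
    exists y : X, forall i, (i < k)%N ->
      bowen_ball d f (xs i) delta lambda (Ms i) (iter (Ns i) f y).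

Definition euclid (m : nat) (v : 'cV[R]_m) : R :=
  Num.sqrt (\sum_(i < m) (v i ord0) ^+ 2).

Definition opnorm (m : nat) (M : 'M[R]_m) : R :=
  sup [set r | exists v : 'cV[R]_m, euclid v <= 1 /\ r = euclid (M *m v)].

Definition holder (d : X -> X -> R) (m : nat) (A : X -> 'M[R]_m) (alpha : R)
  : Prop :=
  exists C : R, forall x y, opnorm (A x - A y) <= C * (d x y) `^ alpha.

Fixpoint cocycle (m : nat) (A : X -> 'M[R]_m) (f : X -> X) (n : nat) (x : X)
  : 'M[R]_m :=
  match n with
  | 0%N => 1%:M
  | n'.+1 => A (iter n' f x) *m cocycle A f n' x
  end.

Definition lyap_seq (m : nat) (A : X -> 'M[R]_m) (f : X -> X) (x : X)
  : nat -> R :=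
  fun n => n%:R^-1 * ln (opnorm (cocycle A f n x)).

Definition MLI (m : nat) (A : X -> 'M[R]_m) (f : X -> X) : set X :=
  [set x | ~ cvg (lyap_seq A f x @ \oo)].

Definition borelX (d : X -> X -> R) := g_sigma_algebraType (mopen d).

Definition ergodic_prob (d : X -> X -> R) (f : X -> X)
  (mu : {measure set (borelX d) -> \bar R}) : Prop :=
  [/\ mu setT = 1%E,
      forall B : set (borelX d), measurable B -> mu (f @^-1` B) = mu B &
      forall B : set (borelX d), measurable B -> f @^-1` B = B ->
        mu B = 0%E \/ mu B = 1%E].

Definition chimax_mu (d : X -> X -> R) (m : nat) (A : X -> 'M[R]_m)
  (f : X -> X) (mu : {measure set (borelX d) -> \bar R}) : R :=
  xget 0 [set c : R | {ae mu, forall x : borelX d, lyap_seq A f x @ \oo --> c}].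

Definition ergodic_exponents (d : X -> X -> R) (m : nat) (A : X -> 'M[R]_m)
  (f : X -> X) : set (\bar R) :=
  [set (@chimax_mu d m A f mu)%:E | mu in [set mu | @ergodic_prob d f mu]].

Definition close_freq (d : X -> X -> R) (f : X -> X) (x y : X) (t : R)
  : nat -> R :=
  fun n => (count (fun i => d (iter i f x) (iter i f y) < t) (iota 0 n))%:R
           / n%:R.

Definition DC1_pair (d : X -> X -> R) (f : X -> X) (x y : X) : Prop :=
  (forall t : R, 0 < t -> limn_sup (close_freq d f x y t) = 1) /\
  (exists2 t0 : R, 0 < t0 & limn_inf (close_freq d f x y t0) = 0).

Definition DC1_scrambled (d : X -> X -> R) (f : X -> X) (S : set X) : Prop :=
  forall x y, S x -> S y -> x <> y -> DC1_pair d f x y.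

End Defs.

(* Main.v *)
(* Let b be the limit of sup_x (1/n) ln |A(x,n)|, an upper bound for every
   exponent.  Along record times n of sup_x ln |A(x,n)| - (b - k) n, a telescoping
   estimate using the Hoelder condition shows that every point exponentially
   shadowing a maximizing segment of length n also grows at rate b.

   If no ergodic measure charges the points that are infinitely often slower than
   some c < b, the growth rate is b almost everywhere for all of them, so there is
   no gap between exponents.  Otherwise Markov's inequality gives arbitrarily long
   segments most of whose times start a block of bounded length of rate < c; by
   submultiplicativity and uniform continuity every point shadowing such a segment
   has rate < b.

   Specification also provides two orbits that stay uniformly apart, by shadowing
   two distinct points along an arithmetic progression of times.  Concatenating
   fast, slow and distal segments, each much longer than the whole past, and
   choosing among the two distal orbits according to a binary sequence, yields
   irregular points that form an uncountable DC1-scrambled set. *)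
Require Import Defs.
From HB Require Import structures.
From mathcomp Require Import all_boot all_order all_algebra.
From mathcomp Require Import all_classical all_reals all_analysis.
From mathcomp Require Import measurable_realfun ring lra zify.
Import Order.TTheory GRing.Theory Num.Theory.
Import numFieldNormedType.Exports.
Local Open Scope classical_set_scope.
Local Open Scope ring_scope.

Set Implicit Arguments.
Unset Strict Implicit.

(** * Operator norm *)

Section OperatorNorm.
Variable R : realType.
Implicit Types m : nat.

Lemma sum_CauchySchwarz (I : finType) (a b : I -> R) :
  (\sum_i a i * b i) ^+ 2 <= (\sum_i a i ^+ 2) * (\sum_i b i ^+ 2).
Proof.
set s := \sum_i a i * b i; set p := \sum_i a i ^+ 2; set q := \sum_i b i ^+ 2.
have q0 : 0 <= q by apply: sumr_ge0 => i _; exact: sqr_ge0.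
have [q_0|q_neq0] := eqVneq q 0.
  have b0 i : b i = 0.
    have : \sum_i b i ^+ 2 == 0 by apply/eqP.
    rewrite psumr_eq0; last by move=> ? _; exact: sqr_ge0.
    by move/allP/(_ i (mem_index_enum i)); rewrite sqrf_eq0 => /eqP.
  by rewrite /s big1 => [|i _]; rewrite ?q_0 ?mulr0 ?expr0n // b0 mulr0.
have : 0 <= \sum_i (q * a i - s * b i) ^+ 2.
  by apply: sumr_ge0 => i _; exact: sqr_ge0.
have -> : \sum_i (q * a i - s * b i) ^+ 2 = q * (p * q - s ^+ 2).
  rewrite (eq_bigr (fun i => q ^+ 2 * a i ^+ 2 +
    (- (2 * q * s) * (a i * b i) + s ^+ 2 * b i ^+ 2))); last by move=> i _; ring.
  rewrite !big_split /= -!mulr_sumr -/s -/p -/q; ring.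
by rewrite pmulr_rge0 ?subr_ge0 // lt_def q_neq0.
Qed.

Lemma euclid_ge0 m (v : 'cV[R]_m) : 0 <= euclid v.
Proof. exact: sqrtr_ge0. Qed.

Lemma euclid_sqr m (v : 'cV[R]_m) : euclid v ^+ 2 = \sum_i v i ord0 ^+ 2.
Proof. by rewrite sqr_sqrtr //; apply: sumr_ge0 => i _; exact: sqr_ge0. Qed.

Lemma euclid0 m : euclid (0 : 'cV[R]_m) = 0.
Proof. by rewrite /euclid big1 ?sqrtr0 // => i _; rewrite mxE expr0n. Qed.

Lemma euclid_eq0 m (v : 'cV[R]_m) : (euclid v == 0) = (v == 0).
Proof.
apply/eqP/eqP => [v0|->]; last exact: euclid0.
apply/colP => i; rewrite mxE.
have /eqP := euclid_sqr v; rewrite v0 expr0n eq_sym psumr_eq0; last first.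
  by move=> ? _; exact: sqr_ge0.
by move/allP/(_ i (mem_index_enum i)); rewrite sqrf_eq0 => /eqP.
Qed.

Lemma euclidZ m a (v : 'cV[R]_m) : euclid (a *: v) = `|a| * euclid v.
Proof.
rewrite /euclid; under eq_bigr do rewrite mxE exprMn.
by rewrite -mulr_sumr sqrtrM ?sqr_ge0 // sqrtr_sqr.
Qed.

Lemma euclidN m (v : 'cV[R]_m) : euclid (- v) = euclid v.
Proof. by rewrite -scaleN1r euclidZ normrN1 mul1r. Qed.

Lemma euclidD m (u v : 'cV[R]_m) : euclid (u + v) <= euclid u + euclid v.
Proof.
rewrite -(@ler_pXn2r _ 2) ?nnegrE ?addr_ge0 ?euclid_ge0 //.
rewrite euclid_sqr; under eq_bigr do rewrite mxE sqrrD.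
rewrite !big_split /= sqrrD -!euclid_sqr lerD2r lerD2l -mulr2n lerMn2r /=.
rewrite (le_trans (ler_norm _)) // -(@ler_pXn2r _ 2) ?nnegrE ?mulr_ge0 ?euclid_ge0 //.
by rewrite real_normK ?num_real // exprMn !euclid_sqr sum_CauchySchwarz.
Qed.

Lemma euclid_mulmx m (M : 'M[R]_m) :
  exists B, forall v : 'cV[R]_m, euclid (M *m v) <= B * euclid v.
Proof.
exists (Num.sqrt (\sum_i \sum_j M i j ^+ 2)) => v.
rewrite /euclid -sqrtrM; last by do 2!apply: sumr_ge0 => ? _; exact: sqr_ge0.
apply: ler_wsqrtr; rewrite mulr_suml; apply: ler_sum => i _.
by rewrite mxE sum_CauchySchwarz.
Qed.

Lemma opnorm_has_sup m (M : 'M[R]_m) :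
  has_sup [set r | exists v : 'cV[R]_m, euclid v <= 1 /\ r = euclid (M *m v)].
Proof.
split; first by exists (euclid (M *m 0)), 0; rewrite euclid0 ler01.
have [B MB] := euclid_mulmx M; exists `|B| => _ [v [v1 ->]].
rewrite (le_trans (MB v)) // (le_trans (ler_norm _)) // normrM.
by rewrite (ger0_norm (euclid_ge0 v)) ler_piMr.
Qed.

Lemma opnormP m (M : 'M[R]_m) v : euclid (M *m v) <= opnorm M * euclid v.
Proof.
have [/eqP v0|v0] := boolP (euclid v == 0).
  move: (v0) => /eqP; rewrite euclid_eq0 => /eqP ->.
  by rewrite mulmx0 euclid0 mulr0.
have v_gt0 : 0 < euclid v by rewrite lt_def v0 euclid_ge0.
rewrite -ler_pdivrMr //; apply: (ub_le_sup (opnorm_has_sup M).2).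
exists ((euclid v)^-1 *: v).
rewrite -scalemxAr !euclidZ ger0_norm ?invr_ge0 ?euclid_ge0 //.
by rewrite mulVf // mulrC.
Qed.

Lemma opnorm_le m (M : 'M[R]_m) B : 0 <= B ->
  (forall v : 'cV[R]_m, euclid (M *m v) <= B * euclid v) -> opnorm M <= B.
Proof.
move=> B0 MB; apply: ge_sup; first exact: (opnorm_has_sup M).1.
by move=> _ [v [v1 ->]]; rewrite (le_trans (MB v)) // ler_piMr.
Qed.

Lemma opnorm_ge0 m (M : 'M[R]_m) : 0 <= opnorm M.
Proof.
rewrite -(euclid0 m) -(mulmx0 _ M); apply: (ub_le_sup (opnorm_has_sup M).2).
by exists 0; rewrite euclid0.
Qed.

Lemma opnormD m (M N : 'M[R]_m) : opnorm (M + N) <= opnorm M + opnorm N.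
Proof.
apply: opnorm_le => [|v]; first by rewrite addr_ge0 ?opnorm_ge0.
by rewrite mulmxDl mulrDl (le_trans (euclidD _ _)) // lerD ?opnormP.
Qed.

Lemma opnormN m (M : 'M[R]_m) : opnorm (- M) = opnorm M.
Proof.
suff H (N : 'M[R]_m) : opnorm (- N) <= opnorm N.
  by apply/eqP; rewrite eq_le H -{1}(opprK M) H.
apply: opnorm_le => [|v]; first exact: opnorm_ge0.
by rewrite mulNmx euclidN opnormP.
Qed.

Lemma opnormM m (M N : 'M[R]_m) : opnorm (M *m N) <= opnorm M * opnorm N.
Proof.
apply: opnorm_le => [|v]; first by rewrite mulr_ge0 ?opnorm_ge0.
rewrite -mulmxA (le_trans (opnormP _ _)) // -mulrA ler_wpM2l ?opnorm_ge0 //.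
exact: opnormP.
Qed.

Lemma opnorm0 m : opnorm (0 : 'M[R]_m) = 0.
Proof.
apply/eqP; rewrite eq_le opnorm_ge0 andbT; apply: opnorm_le => // v.
by rewrite mul0mx euclid0 mul0r.
Qed.

Lemma opnorm_size0 (M : 'M[R]_0) : opnorm M = 0.
Proof. by rewrite flatmx0 opnorm0. Qed.

Lemma opnorm_gt0 m (M : 'M[R]_m.+1) : M \in unitmx -> 0 < opnorm M.
Proof.
move=> Mu; rewrite lt_def opnorm_ge0 andbT; apply/eqP => M0.
have E (v : 'cV[R]_m.+1) : M *m v = 0.
  by apply/eqP; rewrite -euclid_eq0 eq_le euclid_ge0 andbT -(mul0r (euclid v)) -M0 opnormP.
have : (\col_(_ < m.+1) 1 : 'cV[R]_m.+1) = 0 by rewrite -[LHS](mulKmx Mu) E mulmx0.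
by move/colP/(_ ord0)/eqP; rewrite !mxE oner_eq0.
Qed.

Lemma opnorm1 m : opnorm (1%:M : 'M[R]_m.+1) = 1.
Proof.
apply/eqP; rewrite eq_le; apply/andP; split.
  by apply: opnorm_le => // v; rewrite mul1mx mul1r.
have p : 0 < opnorm (1%:M : 'M[R]_m.+1) by rewrite opnorm_gt0 ?unitmx1.
rewrite -(ler_pM2l p) mulr1; have := opnormM (1%:M : 'M[R]_m.+1) 1%:M.
by rewrite mul1mx.
Qed.

End OperatorNorm.

(** * Compactness *)

Lemma common_radius (R : realType) (P : nat -> R -> Prop) N :
  (forall n r s, r <= s -> P n s -> P n r) ->
  (forall n, exists2 r : R, 0 < r & P n r) ->
  exists2 r : R, 0 < r & forall n, (n <= N)%N -> P n r.
Proof.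
move=> PS Pex; elim: N => [|N [r r0 IH]].
  by have [r r0 Pr] := Pex 0%N; exists r => // n; rewrite leqn0 => /eqP ->.
have [s s0 Ps] := Pex N.+1; exists (Num.min r s); first by rewrite lt_min r0.
move=> n; rewrite leq_eqVlt => /orP[/eqP->|nN].
  by apply: PS Ps; rewrite ge_min lexx orbT.
by apply: PS (IH n nN); rewrite ge_min lexx.
Qed.

Section CompactMetric.
Variables (R : realType) (X : pointedType) (d : X -> X -> R).
Hypotheses (dM : is_metric d) (dC : mcompact d).

Let dge0 x y : 0 <= d x y. Proof. by case: dM. Qed.
Let dsym x y : d x y = d y x. Proof. by case: dM. Qed.
Let dtri x y z : d x z <= d x y + d y z. Proof. by case: dM. Qed.

Lemma metric_refl x : d x x = 0.
Proof. by case: dM => _ h _ _; apply/h. Qed.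

Lemma mopen_ball x r : mopen d [set y | d x y < r].
Proof.
move=> y /= yr; exists (r - d x y); first by rewrite subr_gt0.
by move=> z yz; rewrite (le_lt_trans (dtri x y z)) // addrC -ltrBrDr.
Qed.

Lemma compact_local_global (P : set X -> Prop) :
  P set0 -> (forall U V, P U -> P V -> P (U `|` V)) ->
  (forall U V, U `<=` V -> P V -> P U) ->
  (forall x, exists2 r : R, 0 < r & P [set y | d x y < r]) -> P setT.
Proof.
move=> P0 PU PS Pball.
have [|x _|F [FC /finite_seqP[s Fs]] TF] := dC (C := [set U | mopen d U /\ P U]).
- by move=> U [].
- have [r r0 Pr] := Pball x; exists [set y | d x y < r].
    by split=> //; exact: mopen_ball.
  by rewrite /= metric_refl.
apply: (PS _ _ TF).
have {FC} : forall U, U \in s -> P U.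
  by move=> U Us; have [] : [set U | mopen d U /\ P U] U by apply: FC; rewrite Fs.
rewrite {}Fs; elim: s => [_|U s IH sP].
  by apply: (PS _ _ _ P0) => x [].
apply: (PS _ (U `|` \bigcup_(V in [set` s]) V)).
  move=> x [V /=]; rewrite inE => /orP[/eqP->|Vs Vx]; first by left.
  by right; exists V.
apply: PU; first by apply: sP; rewrite mem_head.
by apply: IH => V Vs; apply: sP; rewrite inE Vs orbT.
Qed.

Lemma locally_bounded_bounded (g : X -> R) :
  (forall x, exists2 r : R, 0 < r & exists B, forall y, d x y < r -> g y <= B) ->
  exists B, forall x, g x <= B.
Proof.
move=> gB; suff [B BP] : exists B, forall x, setT x -> g x <= B.
  by exists B => x; exact: BP.
apply: (compact_local_global (P := fun U => exists B, forall x, U x -> g x <= B)) => //.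
- by exists 0.
- move=> U V [B UB] [B' VB']; exists (Num.max B B') => x [/UB|/VB'] h;
    by rewrite le_max h ?orbT.
- by move=> U V UV [B VB]; exists B => x /UV/VB.
Qed.

Lemma continuous_uniform (g : X -> X -> R) :
  (forall x y, g x y = g y x) -> (forall x y z, g x z <= g x y + g y z) ->
  (forall x (e : R), 0 < e -> exists2 r : R, 0 < r & forall y, d x y < r -> g x y < e) ->
  forall e : R, 0 < e -> exists2 r : R, 0 < r & forall x y, d x y < r -> g x y < e.
Proof.
move=> gs gt gc e e0.
suff [r r0 rP] : exists2 r : R, 0 < r &
    forall x, setT x -> forall y, d x y < r -> g x y < e.
  by exists r => // x y; exact: rP.
apply: (compact_local_global (P := fun U => exists2 r : R, 0 < r &
    forall x, U x -> forall y, d x y < r -> g x y < e)) => [|||x] /=.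
- by exists 1 => [|x []].
- move=> U V [r r0 Ur] [r' r'0 Vr']; exists (Num.min r r') => [|x].
    by rewrite lt_min r0.
  by case=> [Ux|Vx] y; rewrite lt_min => /andP[? ?]; [exact: Ur|exact: Vr'].
- by move=> U V UV [r r0 Vr]; exists r => // x /UV; exact: Vr.
have [|r r0 rP] := gc x (e / 2); first by rewrite divr_gt0.
exists (r / 2); first by rewrite divr_gt0.
exists (r / 2); first by rewrite divr_gt0.
move=> y /= xy z yz; rewrite (splitr e) (le_lt_trans (gt y x z)) // ltrD //.
  by rewrite gs rP // (lt_trans xy) // gtr_pMr // invf_lt1 // ltr1n.
by rewrite rP // (le_lt_trans (dtri x y z)) // (splitr r) ltrD.
Qed.

Lemma sequence_cluster (u : nat -> X) :
  exists y, forall (r : R) K, 0 < r -> exists2 k, (K <= k)%N & d y (u k) < r.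
Proof.
apply: contrapT => nex.
suff [K KP] : exists K, forall k, (K <= k)%N -> ~ setT (u k) by exact: (KP K).
apply: (compact_local_global
  (P := fun U => exists K, forall k, (K <= k)%N -> ~ U (u k))) => [|||x] /=.
- by exists 0%N => k _ [].
- move=> U V [K UK] [K' VK']; exists (maxn K K') => k.
  by rewrite geq_max => /andP[/UK nU /VK' nV] [].
- by move=> U V UV [K VK]; exists K => k /VK nV /UV.
move/forallNP: nex => /(_ x)/existsNP[r /existsNP[K]].
move=> /not_implyP[r0 nk]; exists r => //; exists K => k Kk /= xk.
by apply: nk; exists k.
Qed.

End CompactMetric.

(** * Growth of the cocycle *)

Section Cocycle.
Variables (R : realType) (X : pointedType) (d : X -> X -> R) (f : X -> X).
Variables (m : nat) (A : X -> 'M[R]_m.+1) (alpha : R).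
Hypotheses (dM : is_metric d) (dC : mcompact d) (fC : mcontinuous d f).
Hypotheses (Au : forall x, A x \in unitmx) (alpha_gt0 : 0 < alpha).
Hypothesis AH : holder d A alpha.

Definition growth n x := ln (opnorm (cocycle A f n x)).

Lemma mcontinuous_iter n : mcontinuous d (iter n f).
Proof.
elim: n => [|n IH] x e e0; first by exists e.
have [r r0 rP] := fC (iter n f x) e0; have [s s0 sP] := IH x r r0.
by exists s => // y /sP /rP.
Qed.

Lemma cocycleD n k x :
  cocycle A f (n + k) x = cocycle A f k (iter n f x) *m cocycle A f n x.
Proof.
elim: k => [|k IH]; first by rewrite addn0 mul1mx.
by rewrite addnS /= IH mulmxA -iterD addnC.
Qed.

Lemma cocycle_unit n x : cocycle A f n x \in unitmx.
Proof. by elim: n => [|n IH] /=; rewrite ?unitmx1 // unitmx_mul Au. Qed.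

Lemma opnorm_cocycle_gt0 n x : 0 < opnorm (cocycle A f n x).
Proof. exact: opnorm_gt0 (cocycle_unit n x). Qed.

Lemma opnorm_cocycle n x : opnorm (cocycle A f n x) = expR (growth n x).
Proof. by rewrite lnK // posrE opnorm_cocycle_gt0. Qed.

Lemma growth0 x : growth 0 x = 0.
Proof. by rewrite /growth /= opnorm1 ln1. Qed.

Lemma growthD n k x : growth (n + k) x <= growth n x + growth k (iter n f x).
Proof.
rewrite -ler_expR expRD -!opnorm_cocycle cocycleD mulrC.
exact: opnormM.
Qed.

Lemma opnorm_dist m' (M N : 'M[R]_m') : opnorm M <= opnorm N + opnorm (M - N).
Proof. by rewrite -{1}(subrK N M) addrC opnormD. Qed.

Lemma opnorm_distC m' (M N : 'M[R]_m') : opnorm (M - N) = opnorm (N - M).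
Proof. by rewrite -opnormN opprB. Qed.

Lemma holder_uniform (e : R) : 0 < e ->
  exists2 r : R, 0 < r & forall x y, d x y < r -> opnorm (A x - A y) < e.
Proof.
move=> e0; have [C CP] := AH.
have C1 : 0 < `|C| + 1 by rewrite ltr_wpDl.
exists ((e / (`|C| + 1)) `^ alpha^-1); first by apply: powR_gt0; apply: divr_gt0.
move=> x y xy; have d0 : 0 <= d x y by case: dM.
rewrite (le_lt_trans (CP x y)) //.
have : d x y `^ alpha < e / (`|C| + 1).
  have -> : e / (`|C| + 1) = ((e / (`|C| + 1)) `^ alpha^-1) `^ alpha.
    by rewrite -powRrM mulVf ?gt_eqF // powRr1 // divr_ge0 // ltW.
  by rewrite gt0_ltr_powR // nnegrE ?powR_ge0.
rewrite ltr_pdivlMr // => h; apply: le_lt_trans h.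
rewrite mulrC ler_wpM2l ?powR_ge0 // (le_trans (ler_norm _)) //.
by rewrite lerDl.
Qed.

Lemma opnorm_generator_bound : exists2 K : R, 0 < K &
  forall x, opnorm (A x) <= expR K /\ opnorm (invmx (A x)) <= expR K.
Proof.
have [B BP] : exists B, forall x, opnorm (A x) <= B.
  apply: (locally_bounded_bounded dM dC) => x.
  have [r r0 rP] := holder_uniform ltr01; exists r => //.
  exists (opnorm (A x) + 1) => y /rP/ltW xy.
  by rewrite (le_trans (opnorm_dist _ (A x))) // lerD2l opnorm_distC.
have [B' BP'] : exists B, forall x, opnorm (invmx (A x)) <= B.
  apply: (locally_bounded_bounded dM dC) => x.
  set b := opnorm (invmx (A x)).
  have b0 : 0 < b by apply: opnorm_gt0; rewrite unitmx_inv.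
  have [|r r0 rP] := @holder_uniform ((2 * b)^-1); first by rewrite invr_gt0 mulr_gt0.
  exists r => //; exists (2 * b) => y /rP/ltW xy.
  have E : invmx (A y) = invmx (A x) + invmx (A x) *m (A x - A y) *m invmx (A y).
    by rewrite mulmxBr mulVmx // mulmxBl mul1mx -mulmxA mulmxV // mulmx1 addrC subrK.
  have h : opnorm (invmx (A y)) <= b + 2^-1 * opnorm (invmx (A y)).
    rewrite {1}E (le_trans (opnormD _ _)) // lerD2l (le_trans (opnormM _ _)) //.
    rewrite ler_wpM2r ?opnorm_ge0 // (le_trans (opnormM _ _)) //.
    by rewrite (le_trans (ler_wpM2l (ltW b0) xy)) // invfM mulrCA mulfV ?gt_eqF // mulr1.
  lra.
exists (Num.max (ln (Num.max B B' + 1)) 1); first by rewrite lt_max ltr01 orbT.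
have h (b : R) : 0 < b + 1 -> b <= expR (Num.max (ln (b + 1)) 1).
  move=> b0; apply: (@le_trans _ _ (b + 1)); first by rewrite lerDl.
  by rewrite -{1}(lnK (x := b + 1)) ?posrE // ler_expR le_max lexx.
have p : 0 < Num.max B B' + 1.
  by rewrite ltr_wpDl // le_max (le_trans (opnorm_ge0 _) (BP point)).
move=> x; split; apply: (le_trans _ (h _ p)); by rewrite le_max ?BP ?BP' ?orbT.
Qed.

Section Bounded.
Variable K : R.
Hypothesis AK : forall x, opnorm (A x) <= expR K.
Hypothesis AVK : forall x, opnorm (invmx (A x)) <= expR K.

Lemma growth1_le x : growth 1 x <= K.
Proof. by rewrite -ler_expR -opnorm_cocycle /= mulmx1. Qed.

Lemma growth_le n x : growth n x <= K * n%:R.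
Proof.
elim: n => [|n IH]; first by rewrite growth0 mulr0.
rewrite -addn1 (le_trans (growthD _ _ _)) // natrD mulrDr lerD // mulr1.
exact: growth1_le.
Qed.

Lemma growth_iter_le n k x :
  growth k (iter n f x) <= growth (n + k) x + K * n%:R.
Proof.
elim: n x => [|n IH] x; first by rewrite mulr0 addr0.
have h : growth (n + k) (f x) <= growth (n.+1 + k) x + K.
  rewrite -ler_expR expRD -!opnorm_cocycle.
  have -> : cocycle A f (n + k) (f x) = cocycle A f (n.+1 + k) x *m invmx (A x).
    by rewrite (_ : (n.+1 + k)%N = (1 + (n + k))%N) // (cocycleD 1) /= mulmx1 mulmxK.
  by rewrite (le_trans (opnormM _ _)) // ler_wpM2l ?opnorm_ge0.
by rewrite iterSr (le_trans (IH _)) // -(addn1 n) natrD mulrDr mulr1 addn1; lra.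
Qed.

Lemma growth_ge n x : - (K * n%:R) <= growth n x.
Proof.
by have := growth_iter_le n 0 x; rewrite growth0 addn0; lra.
Qed.

Lemma cocycle_continuous n x (e : R) : 0 < e ->
  exists2 r : R, 0 < r & forall y, d x y < r ->
    opnorm (cocycle A f n x - cocycle A f n y) < e.
Proof.
elim: n e => [|n IH] e e0.
  by exists 1 => // y _; rewrite /= subrr opnorm0.
have e1 : 0 < e / 2 / expR K by rewrite !divr_gt0 ?expR_gt0.
have e2 : 0 < e / 2 / expR (K * n%:R) by rewrite !divr_gt0 ?expR_gt0.
have [r r0 rP] := IH _ e1; have [s s0 sP] := holder_uniform e2.
have [t t0 tP] := mcontinuous_iter n x s0.
exists (Num.min r t) => [|y]; first by rewrite lt_min r0.
rewrite lt_min => /andP[/rP xyr /tP/sP xyt] /=.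
set M := A (iter n f x) in xyt *; set N := A (iter n f y) in xyt *.
set C := cocycle A f n x in xyr *; set D := cocycle A f n y in xyr *.
have -> : M *m C - N *m D = M *m (C - D) + (M - N) *m D.
  by rewrite mulmxBr mulmxBl addrA subrK.
rewrite (le_lt_trans (opnormD _ _)) // (splitr e) ltrD //.
  rewrite (le_lt_trans (opnormM _ _)) // (le_lt_trans (ler_wpM2r (opnorm_ge0 _) (AK _))) //.
  by rewrite mulrC -ltr_pdivlMr ?expR_gt0.
rewrite (le_lt_trans (opnormM _ _)) //.
rewrite (@le_lt_trans _ _ (opnorm (M - N) * expR (K * n%:R))) //.
  by rewrite ler_wpM2l ?opnorm_ge0 // opnorm_cocycle ler_expR growth_le.
by rewrite -ltr_pdivlMr ?expR_gt0.
Qed.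

Lemma growth_continuous n x (e : R) : 0 < e ->
  exists2 r : R, 0 < r & forall y, d x y < r -> `|growth n x - growth n y| < e.
Proof.
move=> e0; have e1 : 0 < e / expR (K * n%:R) by rewrite divr_gt0 ?expR_gt0.
have [r r0 rP] := cocycle_continuous n x e1; exists r => // y /rP xy.
have main u v :
    opnorm (cocycle A f n u - cocycle A f n v) < e / expR (K * n%:R) ->
    growth n u - growth n v < e.
  move=> uv; have v0 := opnorm_cocycle_gt0 n v; have u0 := opnorm_cocycle_gt0 n u.
  rewrite /growth -ln_div ?posrE //.
  set a := opnorm (cocycle A f n u) in u0 *; set b := opnorm (cocycle A f n v) in v0 *.
  have ab : a / b = 1 + (a - b) / b by rewrite mulrBl mulfV ?gt_eqF // addrC subrK.
  rewrite ab (le_lt_trans (le_ln1Dx _)) //.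
    by rewrite -(ltrD2l 1) subrr -ab divr_gt0.
  rewrite ltr_pdivrMr // (@le_lt_trans _ _ (opnorm (cocycle A f n u - cocycle A f n v))) //.
    by rewrite lerBlDl opnorm_dist.
  rewrite (lt_le_trans uv) // ler_pM2l // -expRN /b opnorm_cocycle ler_expR.
  exact: growth_ge.
by rewrite ltr_norml ltrNl opprB !main // opnorm_distC.
Qed.

End Bounded.
End Cocycle.

(** * Fast segments *)

Section RealSequences.
Variable R : realType.

Lemma subadditive_rate (s : nat -> R) (K : R) :
  (forall n, `|s n| <= K * n%:R) -> (forall n k, s (n + k)%N <= s n + s k) ->
  exists b : R, (forall n, b * n%:R <= s n) /\
    forall e : R, 0 < e -> exists2 C : R, 0 <= C & forall n, s n <= (b + e) * n%:R + C.
Proof.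
move=> sK sD.
have K0 : 0 <= K by have := sK 1%N; rewrite mulr1; apply: le_trans.
have s0 : s 0%N = 0 by apply/eqP; rewrite -normr_le0 (le_trans (sK _)) // mulr0.
pose E := [set r | exists n, r = s n.+1 / n.+1%:R].
have Einf : has_inf E.
  split; first by exists (s 1%N / 1%:R), 0%N.
  exists (- K) => _ [n ->]; rewrite ler_pdivlMr ?ltr0n // mulNr.
  by have := sK n.+1; rewrite ler_norml => /andP[].
exists (inf E); split=> [[|n]|e e0]; first by rewrite mulr0 s0.
  rewrite -ler_pdivlMr ?ltr0n //; apply: ge_inf; first exact: Einf.2.
  by exists n.
have [_ [p ->]] := inf_adherent e0 Einf; rewrite ltr_pdivrMr ?ltr0n // => /ltW sp.
exists ((K + `|inf E + e|) * p.+1%:R); first by rewrite mulr_ge0 ?addr_ge0.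
have smul q : s (q * p.+1)%N <= (inf E + e) * (q * p.+1)%:R.
  elim: q => [|q IH]; first by rewrite mul0n s0 mulr0.
  by rewrite mulSn (le_trans (sD _ _)) // natrD mulrDr lerD.
move=> n; rewrite {1 2}(divn_eq n p.+1) (le_trans (sD _ _)) // natrD mulrDr -addrA lerD //.
have rp : (n %% p.+1)%:R <= p.+1%:R :> R by rewrite ler_nat ltnW ?ltn_mod.
have h1 : s (n %% p.+1)%N <= K * p.+1%:R.
  by rewrite (le_trans (ler_norm _)) // (le_trans (sK _)) // ler_wpM2l.
have h2 : - ((inf E + e) * (n %% p.+1)%:R) <= `|inf E + e| * p.+1%:R.
  by rewrite -mulNr (@le_trans _ _ (`|inf E + e| * (n %% p.+1)%:R)) ?ler_wpM2r
    ?ler_wpM2l // -normrN ler_norm.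
by rewrite mulrDl; move: h1 h2; lra.
Qed.

Lemma record_times (t : nat -> R) (k : R) : (forall n, 0 <= t n) -> 0 < k ->
  forall N, exists2 n, (N <= n)%N &
    forall j, (j <= n)%N -> t j + k * j%:R <= t n + k * n%:R.
Proof.
move=> t0 k0 N; pose u j := t j + k * j%:R.
have u0 j : 0 <= u j by rewrite addr_ge0 // mulr_ge0 // ltW.
pose p := Num.bound ((\sum_(j < N) u j) / k).
have up : \sum_(j < N) u j < u p.
  rewrite (@lt_le_trans _ _ (k * p%:R)) ?lerDr // mulrC -ltr_pdivrMr //.
  by rewrite archi_boundP // divr_ge0 ?sumr_ge0 // ltW.
case: (@arg_maxP _ _ _ (ord_max : 'I_p.+1) xpredT (fun i : 'I_p.+1 => u i)) => // n _ nmax.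
exists n; last first.
  by move=> j jn; exact: (nmax (Ordinal (leq_ltn_trans jn (ltn_ord n)))).
rewrite leqNgt; apply/negP => nN; have := nmax ord_max isT; apply/negP.
rewrite -ltNge /= (le_lt_trans _ up) // (bigD1 (Ordinal nN)) //= lerDl.
by rewrite sumr_ge0.
Qed.

Lemma sum_expR_minn (k : R) n : 0 < k ->
  \sum_(i < n) expR (- (k * (minn i (n - i))%:R)) <= 2 / (1 - expR (- k)).
Proof.
move=> k0; set q := expR (- k).
have q0 : 0 < q by exact: expR_gt0.
have q1 : 0 < 1 - q by rewrite subr_gt0 -expR0 ltr_expR ltrNl oppr0.
have geo : \sum_(i < n) q ^+ i <= (1 - q)^-1.
  rewrite -[leRHS]mul1r ler_pdivlMr // mulrC -opprB mulNr -subrX1 opprB.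
  by rewrite gerBl exprn_ge0 // ltW.
have E j : expR (- (k * j%:R)) = q ^+ j by rewrite /q -mulNr mulrC expRM_natl.
apply: (@le_trans _ _ (\sum_(i < n) (q ^+ i + q ^+ (n - i)))).
  apply: ler_sum => i _; rewrite E; case: leqP => _.
    by rewrite lerDl exprn_ge0 // ltW.
  by rewrite lerDr exprn_ge0 // ltW.
rewrite big_split /= mulrDl mul1r lerD //.
rewrite (reindex_inj rev_ord_inj) /=; apply: le_trans geo.
apply: ler_sum => i _; rewrite subKn // exprS ger_pMl ?exprn_gt0 //.
by rewrite ltW // -subr_gt0.
Qed.

Lemma record_left (b k C s s1 s2 i n : R) :
  s1 <= (b + k) * i + C ->
  s2 - b * (n - i - 1) + k * (n - i - 1) <= s - b * n + k * n ->
  s2 + s1 + - (4 * k * i) <= s + (C + k - b) + - (2 * k * i).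
Proof. lra. Qed.

Lemma record_right (b k C s s1 s2 i n : R) : 0 <= k ->
  s2 <= (b + k) * (n - i - 1) + C ->
  s1 - b * i + k * i <= s - b * n + k * n ->
  s2 + s1 + - (4 * k * (n - i)) <= s + (C + k - b) + - (2 * k * (n - i)).
Proof. lra. Qed.

End RealSequences.

Section FastSegments.
Variables (R : realType) (X : pointedType) (d : X -> X -> R) (f : X -> X).
Variables (m : nat) (A : X -> 'M[R]_m.+1) (alpha : R).
Hypotheses (dM : is_metric d) (dC : mcompact d) (fC : mcontinuous d f).
Hypotheses (Au : forall x, A x \in unitmx) (alpha_gt0 : 0 < alpha).
Hypothesis AH : holder d A alpha.

Lemma cocycle_telescope n x z :
  cocycle A f n z - cocycle A f n x =
  \sum_(i < n) cocycle A f (n - i.+1) (iter i.+1 f z) *m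
    (A (iter i f z) - A (iter i f x)) *m cocycle A f i x.
Proof.
elim: n => [|n IH]; first by rewrite subrr big_ord0.
rewrite big_ord_recr /= subnn mul1mx.
have -> : A (iter n f z) *m cocycle A f n z - A (iter n f x) *m cocycle A f n x =
    A (iter n f z) *m (cocycle A f n z - cocycle A f n x) +
    (A (iter n f z) - A (iter n f x)) *m cocycle A f n x.
  by rewrite mulmxBr mulmxBl addrA subrK.
congr (_ + _); rewrite IH mulmx_sumr; apply: eq_bigr => i _.
rewrite !mulmxA; congr (_ *m _ *m _).
by rewrite subSn //= -iterS -iterD subnK.
Qed.

Lemma opnorm_sum m' (I : finType) (F : I -> 'M[R]_m') :
  opnorm (\sum_i F i) <= \sum_i opnorm (F i).
Proof.
apply: (big_ind2 (fun u v => opnorm u <= v)) => //; first by rewrite opnorm0.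
by move=> ? ? ? ? h1 h2; rewrite (le_trans (opnormD _ _)) // lerD.
Qed.

Definition max_growth n := sup (range (growth f A n)).

Section Bounded.
Variable K : R.
Hypotheses (AK : forall x, opnorm (A x) <= expR K).
Hypothesis AVK : forall x, opnorm (invmx (A x)) <= expR K.

Lemma growth_has_sup n : has_sup (range (growth f A n)).
Proof.
split; first by exists (growth f A n point), point.
by exists (K * n%:R) => _ [x _ <-]; exact: growth_le.
Qed.

Lemma growth_le_max n x : growth f A n x <= max_growth n.
Proof. by apply: (ub_le_sup (growth_has_sup n).2); exists x. Qed.

Lemma max_growth_le n B : (forall x, growth f A n x <= B) -> max_growth n <= B.
Proof.
move=> h; apply: ge_sup; first exact: (growth_has_sup n).1.
by move=> _ [x _ <-].
Qed.

Lemma max_growthD n k : max_growth (n + k) <= max_growth n + max_growth k.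
Proof.
apply: max_growth_le => x.
by rewrite (le_trans (growthD _ Au _ _ _)) // lerD ?growth_le_max.
Qed.

Lemma max_growth_norm n : `|max_growth n| <= K * n%:R.
Proof.
rewrite ler_norml (le_trans _ (growth_le_max n point)) /=.
  by apply: max_growth_le => x; exact: growth_le.
exact: growth_ge.
Qed.

Lemma cocycle_perturb n x z :
  opnorm (cocycle A f n z - cocycle A f n x) <=
  \sum_(i < n) expR (max_growth (n - i.+1) + max_growth i) *
    opnorm (A (iter i f z) - A (iter i f x)).
Proof.
rewrite cocycle_telescope (le_trans (opnorm_sum _)) //; apply: ler_sum => i _.
rewrite (le_trans (opnormM _ _)) // expRD mulrAC ler_pM ?opnorm_ge0 //.
  rewrite (le_trans (opnormM _ _)) // ler_wpM2r ?opnorm_ge0 //.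
  by rewrite opnorm_cocycle // ler_expR growth_le_max.
by rewrite opnorm_cocycle // ler_expR growth_le_max.
Qed.

(* At a record time [n] of [max_growth i - (b - k) i] both factors around the
   [i]-th perturbation are controlled by [max_growth n], up to an exponential
   in the distance of [i] to the endpoints, which the Hoelder decay absorbs. *)
Lemma fast_segments (b lam : R) : 0 < lam ->
  (forall n, b * n%:R <= max_growth n) ->
  (forall e : R, 0 < e -> exists2 C : R, 0 <= C &
    forall n, max_growth n <= (b + e) * n%:R + C) ->
  exists2 del : R, 0 < del & forall N, exists2 n, (N <= n)%N &
    exists x, forall z, bowen_ball d f x del lam n z ->
      b * n%:R - 2 <= growth f A n z.
Proof.
move=> lam0 bmax maxb; have [k kE] : exists k, lam * alpha = 4 * k.
  by exists (lam * alpha / 4); rewrite [RHS]mulrC divfK.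
have k0 : 0 < k by rewrite -(pmulr_rgt0 k (_ : 0 < 4)) // -kE mulr_gt0.
have [C C0 CP] := maxb k k0.
have [H HP] := AH; pose H' := Num.max H 0.
have H'0 : 0 <= H' by rewrite le_max lexx orbT.
have AH' x y : opnorm (A x - A y) <= H' * d x y `^ alpha.
  by rewrite (le_trans (HP x y)) // ler_wpM2r ?powR_ge0 // le_max lexx.
pose D := expR (C + k - b) * H' * (2 / (1 - expR (- (2 * k)))).
have q1 : 0 < 1 - expR (- (2 * k)) by rewrite subr_gt0 expR_lt1; lra.
have D0 : 0 <= D by rewrite !mulr_ge0 ?expR_ge0 // invr_ge0 ltW.
pose e := expR (- 2) / (D + 1); have e0 : 0 < e by rewrite divr_gt0 ?expR_gt0 ?ltr_wpDl.
exists (e `^ alpha^-1); first exact: powR_gt0.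
set del := e `^ alpha^-1.
have del_alpha : del `^ alpha = e.
  by rewrite -powRrM mulVf ?gt_eqF // powRr1 // ltW.
move=> N; have [|n Nn nrec] := @record_times _ (fun j => max_growth j - b * j%:R) k _ k0 N.
  by move=> j; rewrite subr_ge0.
exists n => //.
have [_ [x _ <-] xmax] := @sup_adherent _ _ 1 ltr01 (growth_has_sup n).
exists x => z zx.
have pert : opnorm (cocycle A f n z - cocycle A f n x) <= expR (max_growth n) * expR (- 2).
  apply: (le_trans (cocycle_perturb n x z)).
  apply: (@le_trans _ _ (\sum_(i < n) expR (max_growth n) * (expR (C + k - b) * H' * e) *
      expR (- (2 * k * (minn i (n - i))%:R)))).
    apply: ler_sum => i _.
    have di := zx i (ltnW (ltn_ord i)).
    have dA : opnorm (A (iter i f z) - A (iter i f x)) <=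
        H' * e * expR (- (4 * k * (minn i (n - i))%:R)).
      rewrite opnorm_distC (le_trans (AH' _ _)) // -mulrA ler_wpM2l //.
      rewrite -del_alpha (_ : expR _ = expR (- lam * (minn i (n - i))%:R) `^ alpha).
        rewrite -powRM ?expR_ge0 ?powR_ge0 // ge0_ler_powR ?nnegrE ?mulr_ge0 ?expR_ge0 ?powR_ge0 //.
        - exact: ltW.
        - by case: dM.
        - exact: ltW.
      by rewrite /powR gt_eqF ?expR_gt0 // expRK; congr expR; rewrite -kE; ring.
    rewrite (le_trans (ler_wpM2l (expR_ge0 _) dA)) //.
    rewrite (_ : _ * (H' * e * _) = H' * e *
      (expR (max_growth (n - i.+1) + max_growth i) *
       expR (- (4 * k * (minn i (n - i))%:R)))); last by ring.
    rewrite (_ : expR (max_growth n) * _ * _ = H' * e *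
      (expR (max_growth n) * expR (C + k - b) * expR (- (2 * k * (minn i (n - i))%:R))));
      last by ring.
    have He : 0 <= H' * e by rewrite mulr_ge0 // ltW.
    apply: ler_wpM2l => //; rewrite -!expRD ler_expR.
    have r1 := nrec i (ltnW (ltn_ord i)); have r2 := nrec (n - i.+1)%N (leq_subr _ _).
    have c1 := CP i; have c2 := CP (n - i.+1)%N.
    have nE : (n - i.+1)%:R = n%:R - i%:R - 1 :> R.
      by rewrite natrB // -natr1 opprD addrA.
    rewrite nE in r2 c2.
    case: leqP => ih.
      exact: record_left c1 r2.
    rewrite natrB ?(ltnW (ltn_ord i)) //.
    exact: record_right (ltW k0) c2 r1.
  rewrite -mulr_sumr -mulrA ler_wpM2l ?expR_ge0 //.
  have k2 : 0 < 2 * k by rewrite mulr_gt0.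
  have g0 : 0 <= expR (C + k - b) * H' * e.
    by apply: mulr_ge0; [rewrite mulr_ge0 ?expR_ge0|exact: ltW].
  apply: (le_trans (ler_wpM2l g0 (sum_expR_minn n k2))).
  rewrite mulrAC -/D /e mulrCA ler_piMr ?expR_ge0 // ler_pdivrMr ?ltr_wpDl //.
  by rewrite mul1r lerDl.
have half : expR (max_growth n - 2) <= opnorm (cocycle A f n z).
  have h := opnorm_dist (cocycle A f n x) (cocycle A f n z).
  rewrite opnorm_distC in h.
  have h1 : expR (max_growth n - 1) <= opnorm (cocycle A f n x).
    by rewrite opnorm_cocycle // ler_expR ltW.
  have h2 : 2 * expR (max_growth n - 2) <= expR (max_growth n - 1).
    rewrite (_ : max_growth n - 1 = 1 + (max_growth n - 2)); last by ring.
    by rewrite [leRHS]expRD ler_wpM2r ?expR_ge0 // -[2]/(1 + 1) expR_ge1Dx.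
  by rewrite -expRD in pert; lra.
have := half; rewrite opnorm_cocycle // ler_expR; apply: le_trans.
by rewrite lerD2r.
Qed.

End Bounded.
End FastSegments.

(** * Slow segments *)

(* Cover [i, i + L) greedily by slow blocks, and by single steps at bad times. *)
Lemma block_cover (R : realType) (a : nat -> nat -> R) (c W : R) (M N : nat)
    (bad : pred nat) :
  (forall i n k, a i (n + k)%N <= a i n + a (i + n)%N k) -> 0 <= W ->
  (forall i n, a i n <= (c + W) * n%:R) ->
  (forall i, (i < M)%N -> ~~ bad i -> exists2 n, (0 < n <= N)%N & a i n <= c * n%:R) ->
  forall L i, (i + L <= M)%N ->
    a i L <= c * L%:R + W * (count bad (iota i L))%:R + W * N%:R.
Proof.
move=> aD W0 aW good L.
have step i n L' : (n <= L')%N ->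
    a (i + n)%N (L' - n)%N <= c * (L' - n)%:R +
      W * (count bad (iota (i + n) (L' - n)))%:R + W * N%:R ->
    a i n <= c * n%:R + W * (count bad (iota i n))%:R ->
    a i L' <= c * L'%:R + W * (count bad (iota i L'))%:R + W * N%:R.
  move=> nL h1 h2; rewrite -{1 2 3}(subnKC nL) iotaD count_cat !natrD.
  rewrite (le_trans (aD _ _ _)) // (le_trans (lerD h2 h1)) // le_eqVlt.
  by apply/orP; left; apply/eqP; ring.
have [k] := ubnP L; elim: k L => // k IH [|L] Lk i iL.
  by rewrite (le_trans (aW i 0%N)) // !mulr0 !add0r mulr_ge0.
have [ib|ig] := boolP (bad i).
  apply: (step i 1%N) => //; first by apply: IH; lia.
  by rewrite (le_trans (aW i 1%N)) //= ib mulrDl.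
have [|n /andP[n0 nN] an] := good i _ ig; first by lia.
have [nL|Ln] := leqP n L.+1.
  apply: (step i n) => //; first by apply: IH; lia.
  by rewrite (le_trans an) // lerDl mulr_ge0.
rewrite (le_trans (aW i L.+1)) // mulrDl -addrA lerD2l.
rewrite -[leLHS]add0r lerD ?mulr_ge0 // ler_wpM2l // ler_nat; lia.
Qed.


Section SlowSegments.
Variables (R : realType) (X : pointedType) (d : X -> X -> R) (f : X -> X).
Variables (m : nat) (A : X -> 'M[R]_m.+1) (alpha : R).
Hypotheses (dM : is_metric d) (dC : mcompact d) (fC : mcontinuous d f).
Hypotheses (Au : forall x, A x \in unitmx) (alpha_gt0 : 0 < alpha).
Hypothesis AH : holder d A alpha.
Variable K : R.
Hypotheses (AK : forall x, opnorm (A x) <= expR K).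
Hypothesis AVK : forall x, opnorm (invmx (A x)) <= expR K.

Definition slow_set (c : R) (N : nat) : set X :=
  [set x | exists2 n, (0 < n <= N)%N & growth f A n x < c * n%:R].

Definition often_slow (c : R) : Prop :=
  forall e : R, 0 < e -> exists N, forall M, exists x,
    (count (fun i => iter i f x \in ~` slow_set c N) (iota 0 M))%:R <= e * M%:R.

Lemma growth_uniform N (e : R) : 0 < e -> exists2 r : R, 0 < r & forall n,
  (n <= N)%N -> forall x y, d x y < r -> `|growth f A n x - growth f A n y| < e.
Proof.
move=> e0; apply: common_radius => [n r s rs sP x y xy|n].
  by apply: sP; exact: lt_le_trans rs.
apply: (continuous_uniform dM dC) => //.
- by move=> x y; exact: distrC.
- by move=> x y z; exact: ler_distD.
by move=> x e' e'0; exact: (growth_continuous dM fC Au alpha_gt0 AH AK AVK).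
Qed.

Lemma slow_segments (c c' : R) : often_slow c -> c < c' ->
  exists eta C : R, 0 < eta /\ forall M, exists x, forall z,
    (forall i, (i < M)%N -> d (iter i f x) (iter i f z) < eta) ->
    growth f A M z <= c' * M%:R + C.
Proof.
move=> slow cc'; pose h := (c' - c) / 2; pose W := `|K - (c + h)| + 1.
have h0 : 0 < h by rewrite divr_gt0 // subr_gt0.
have W0 : 0 < W by rewrite ltr_wpDl.
have [N NP] := slow _ (divr_gt0 h0 W0).
have [eta eta0 etaP] := growth_uniform N h0.
exists eta, (W * N%:R); split=> // M; have [x xM] := NP M; exists x => z xz.
pose bad i := iter i f x \in ~` slow_set c N.
apply: (le_trans (@block_cover R (fun i n => growth f A n (iter i f z)) (c + h) W M N bad
    _ (ltW W0) _ _ M 0%N (leqnn _))).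
- by move=> i n k; rewrite (addnC i n) iterD; exact: growthD.
- move=> i n; rewrite (le_trans (growth_le f Au AK n _)) // ler_wpM2r // /W.
  by have := ler_norm (K - (c + h)); lra.
- move=> i iM; rewrite notin_setE /= notK => -[n /andP[n0 nN] xn].
  exists n; rewrite ?n0 //= ltW // mulrDl.
  have := etaP n nN _ _ (xz i iM); rewrite ltr_distlC => /andP[_ zn].
  by rewrite (lt_le_trans zn) // lerD ?(ltW xn) // ler_peMr ?(ltW h0) // ler1n.
rewrite lerD2r (_ : c' = c + h + h); last by rewrite /h; lra.
rewrite [leRHS]mulrDl lerD2l (le_trans (ler_wpM2l (ltW W0) xM)) //.
by rewrite mulrA mulrCA mulfV ?gt_eqF // mulr1.
Qed.

(* Asking for every [k], rather than for infinitely many [n], makes the set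
   exactly [f]-invariant. *)
Definition slow_limit (c : R) : set X :=
  [set x | forall k : nat, exists n, growth f A n x < c * n%:R - k%:R].

Lemma slow_limit_invariant c : f @^-1` slow_limit c = slow_limit c.
Proof.
pose B := Num.bound (`|K| + `|c|).
have BP : `|K| + `|c| < B%:R by rewrite archi_boundP ?addr_ge0.
have cN : - `|c| <= c by rewrite -[leRHS]opprK lerN2 -normrN ler_norm.
have cP := ler_norm c; have KP := ler_norm K.
apply/seteqP; split=> x /= xs k; have [n] := xs (k + B)%N; rewrite natrD => h.
  exists n.+1; rewrite -addn1 addnC (le_lt_trans (growthD _ Au _ _ _)) // natrD mulrDr.
  have := growth1_le f Au AK x; rewrite /=; move: h; lra.
case: n h => [|n] h.
  rewrite growth0 mulr0 in h; have : 0 <= k%:R + B%:R :> R by rewrite addr_ge0.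
  by move: h; lra.
exists n; have := growth_iter_le f Au AVK 1 n x; rewrite /= add1n mulr1.
by move: h; rewrite -addn1 natrD mulrDr mulr1; lra.
Qed.

Lemma not_slow_limit c x : ~ slow_limit c x ->
  exists k : nat, forall n, c * n%:R - k%:R <= growth f A n x.
Proof.
move/existsNP => [k /forallNP kP]; exists k => n.
by rewrite leNgt; apply/negP; exact: kP.
Qed.

Lemma mopen_growth n r : mopen d [set x | growth f A n x < r].
Proof.
move=> x /= xr; have [|s s0 sP] := growth_continuous dM fC Au alpha_gt0 AH AK AVK n x
    (e := r - growth f A n x).
  by rewrite subr_gt0.
exists s => // y /sP; rewrite ltr_distlC => /andP[_]; rewrite addrC subrK.
by apply.
Qed.

Lemma mopen_slow_set c N : mopen d (slow_set c N).
Proof.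
move=> x [n nN xn]; have [s s0 sP] := mopen_growth xn.
by exists s => // y /sP yn; exists n.
Qed.

Lemma mopen_preimage n U : mopen d U -> mopen d (iter n f @^-1` U).
Proof.
move=> Uo x /= /Uo[r r0 rP]; have [s s0 sP] := mcontinuous_iter fC n x r0.
by exists s => // y /sP ys; exact: rP.
Qed.

Lemma mopen_measurable (U : set X) : mopen d U -> measurable (U : set (borelX d)).
Proof. by move=> Uo; exact: sub_sigma_algebra. Qed.

Lemma measurable_slow_limit c : measurable (slow_limit c : set (borelX d)).
Proof.
have -> : slow_limit c =
    \bigcap_(k : nat) \bigcup_n [set x | growth f A n x < c * n%:R - k%:R].
  apply/seteqP; split=> x xs.
    by move=> k _; have [n xn] := xs k; exists n.
  by move=> k; have [n _ xn] := xs k I; exists n.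
apply: bigcapT_measurable => k; apply: bigcupT_measurable => n.
by apply: mopen_measurable; exact: mopen_growth.
Qed.

End SlowSegments.

Section RareVisits.
Context (disp : measure_display) (T : measurableType disp) (R : realType).
Variables (F : T -> T) (mu : {measure set T -> \bar R}).
Hypothesis mu1 : mu setT = 1%E.
Hypothesis muF : forall B : set T, measurable B -> mu (F @^-1` B) = mu B.

Lemma measure_iter_preimage n (B : set T) :
  (forall k, measurable (iter k F @^-1` B)) -> mu (iter n F @^-1` B) = mu B.
Proof.
move=> Bm; elim: n => [//|n IH].
rewrite -IH -(muF (Bm n)); congr (mu _); apply/seteqP.
by split=> x; rewrite /preimage /= -iterSr.
Qed.

Lemma rare_visits (B : set T) (e : R) M : (0 < M)%N ->
  (forall k, measurable (iter k F @^-1` B)) -> (mu B < e%:E)%E ->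
  exists x, (count (fun i => iter i F x \in B) (iota 0 M))%:R <= e * M%:R.
Proof.
move=> M0 Bm muB; apply: contrapT => /forallNP all_x.
pose g (i : nat) (x : T) : \bar R := (\1_(iter i F @^-1` B) x)%:E.
have gm i : measurable_fun setT (g i).
  by apply/measurable_EFinP; exact: measurable_indic.
have g0 i x : setT x -> (0 <= g i x)%E by move=> _; rewrite lee_fin.
have muB0 : (0 <= mu B)%E by exact: measure_ge0.
have e0 : 0 <= e by rewrite -lee_fin (le_trans muB0 (ltW muB)).
have : (\int[mu]_(x in setT) cst (e * M%:R)%:E x <=
    \int[mu]_(x in setT) (\sum_(i <- iota 0 M) g i x))%E.
  apply: ge0_le_integral => //.
  - by move=> x _; rewrite lee_fin mulr_ge0.
  - exact: emeasurable_sum.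
  move=> x _; rewrite sumEFin lee_fin ltW //.
  have := all_x x; move/negP; rewrite -ltNge => /lt_le_trans; apply.
  rewrite -sum1_count natr_sum big_mkcond /=; apply: ler_sum => i _.
  have -> : (iter i F x \in B) = (x \in iter i F @^-1` B).
    by apply/idP/idP; rewrite !in_setE.
  by rewrite indicE; case: (x \in _).
rewrite integral_cst // mu1 mule1 ge0_integral_sum //.
rewrite (eq_bigr (fun=> mu B)); last first.
  by move=> i _; rewrite integral_indic // setIT measure_iter_preimage.
have muBfin : mu B \is a fin_num by rewrite ge0_fin_numE // (lt_trans muB) ?ltry.
rewrite -(fineK muBfin) sumEFin lee_fin -[X in iota _ X]subn0 sumr_const_nat subn0.
rewrite -(fineK muBfin) lte_fin in muB.
by apply/negP; rewrite -ltNge -[ltLHS]mulr_natr ltr_pM2r ?ltr0n.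
Qed.

End RareVisits.

Lemma rate_cvg (R : realType) (g : nat -> R) (b : R) :
  (forall e : R, 0 < e -> exists C : R, forall n, g n <= (b + e) * n%:R + C) ->
  (forall e : R, 0 < e -> exists C : R, forall n, (b - e) * n%:R - C <= g n) ->
  (fun n => n%:R^-1 * g n) @ \oo --> b.
Proof.
move=> up low; apply/cvgrPdist_le => e e0.
have e2 : 0 < e / 2 by rewrite divr_gt0.
have [C CP] := up _ e2; have [C' CP'] := low _ e2.
pose N := Num.bound (Num.max `|C| `|C'| / (e / 2)).
have NP : Num.max `|C| `|C'| < N%:R * (e / 2).
  by rewrite -ltr_pdivrMr // archi_boundP // divr_ge0 ?le_max ?normr_ge0 // ltW.
near=> n.
have nN : N%:R <= n%:R :> R by rewrite ler_nat; near: n; exact: nbhs_infty_ge.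
have n0 : 0 < n%:R :> R by rewrite ltr0n; near: n; exact: nbhs_infty_gt.
have Cn : Num.max `|C| `|C'| <= n%:R * (e / 2).
  by rewrite (le_trans (ltW NP)) // ler_wpM2r // ltW.
move: Cn; rewrite ge_max => /andP[/(le_trans (ler_norm _)) Cn /(le_trans (ler_norm _)) Cn'].
have -> : b - n%:R^-1 * g n = n%:R^-1 * (b * n%:R - g n).
  by rewrite mulrBr mulrCA mulVf ?gt_eqF // mulr1.
rewrite normrM ger0_norm ?invr_ge0 ?ler0n // mulrC ler_pdivrMr // ler_norml.
by apply/andP; split; move: (CP n) (CP' n) Cn Cn'; lra.
Unshelve. all: by end_near.
Qed.

Section Exponents.
Variables (R : realType) (X : pointedType) (d : X -> X -> R) (f : X -> X).
Variables (m : nat) (A : X -> 'M[R]_m).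

Lemma chimax_of_ae (mu : {measure set (borelX d) -> \bar R}) b :
  ergodic_prob f mu ->
  {ae mu, forall x : borelX d, lyap_seq A f x @ \oo --> b} ->
  chimax_mu A f mu = b.
Proof.
move=> [mu1 _ _] conv; apply: xget_unique => // c cc.
have mu_gt0 : (0 < mu setT)%E by rewrite mu1.
have := ae_properfilter_algebraOfSetsType mu_gt0 => PF.
have [x [xb xc]] := filter_ex (filterI conv cc).
exact: (cvg_unique _ xc xb).
Qed.

Lemma constant_exponents_no_gap b :
  (forall mu : {measure set (borelX d) -> \bar R},
     ergodic_prob f mu -> chimax_mu A f mu = b) ->
  (ereal_sup (ergodic_exponents d A f) <= ereal_inf (ergodic_exponents d A f))%E.
Proof.
move=> chi_b.
have all_b r : ergodic_exponents d A f r -> r = b%:E by move=> [mu /chi_b -> <-].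
rewrite (@le_trans _ _ b%:E) //; first by apply: ge_ereal_sup => r /all_b ->.
by apply: le_ereal_inf_tmp => r /all_b ->.
Qed.

End Exponents.

Section SlowDichotomy.
Variables (R : realType) (X : pointedType) (d : X -> X -> R) (f : X -> X).
Variables (m : nat) (A : X -> 'M[R]_m.+1) (alpha : R).
Hypotheses (dM : is_metric d) (dC : mcompact d) (fC : mcontinuous d f).
Hypotheses (Au : forall x, A x \in unitmx) (alpha_gt0 : 0 < alpha).
Hypothesis AH : holder d A alpha.
Variable K : R.
Hypotheses (AK : forall x, opnorm (A x) <= expR K).
Hypothesis AVK : forall x, opnorm (invmx (A x)) <= expR K.

Lemma often_slow_of_measure (mu : {measure set (borelX d) -> \bar R}) c :
  ergodic_prob f mu -> mu (slow_limit f A c) = 1%E -> often_slow f A c.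
Proof.
move=> [mu1 muf _] muD e e0.
have DM : measurable (slow_limit f A c : set (borelX d)).
  exact: (measurable_slow_limit dM fC Au alpha_gt0 AH AK AVK).
pose B N : set (borelX d) := ~` slow_set f A c N.
have So N : mopen d (slow_set f A c N).
  exact: (mopen_slow_set dM fC Au alpha_gt0 AH AK AVK).
have BM N k : measurable (iter k f @^-1` B N : set (borelX d)).
  rewrite /B preimage_setC; apply: measurableC; apply: mopen_measurable.
  exact: (mopen_preimage fC (So N)).
have D0 : mu (~` slow_limit f A c) = 0%E.
  have : mu (slow_limit f A c `|` ~` slow_limit f A c) =
      (mu (slow_limit f A c) + mu (~` slow_limit f A c))%E.
    by rewrite measureU ?setICr //; exact: measurableC.
  rewrite setUv mu1 muD.
  case: (mu (~` slow_limit f A c)) (measure_ge0 mu (~` slow_limit f A c)) => [r| |] //=.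
  by move=> _ [] /eqP; rewrite -subr_eq0 opprD addrA subrr add0r oppr_eq0 => /eqP ->.
have [N muN] : exists N, (mu (B N) < e%:E)%E.
  apply: contrapT => /forallNP nlt.
  have : (mu \o B) x @[x --> \oo] --> mu (\bigcap_n B n).
    apply: nonincreasing_cvg_mu => //.
    - apply: (@le_lt_trans _ _ (mu setT)); last by rewrite mu1 ltry.
      by apply: le_measure; rewrite ?inE //; exact: (BM _ 0%N).
    - by move=> i; exact: (BM i 0%N).
    - by apply: bigcapT_measurable => i; exact: (BM i 0%N).
    move=> i j ij; apply/subsetPset => x Bx [n /andP[n0 ni] xn]; apply: Bx.
    by exists n => //; rewrite n0 (leq_trans ni).
  have -> : mu (\bigcap_n B n) = 0%E.
    apply/eqP; rewrite eq_le measure_ge0 andbT -D0; apply: le_measure; rewrite ?inE.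
    - by apply: bigcapT_measurable => i; exact: (BM i 0%N).
    - exact: measurableC.
    move=> x Bx Dx; have [[|n] xn] := Dx 0%N.
      by move: xn; rewrite growth0 mulr0 subr0 ltxx.
    by apply: (Bx n.+1 I); exists n.+1; rewrite ?leqnn //; move: xn; rewrite subr0.
  move=> h; suff : (e%:E <= 0)%E by rewrite lee_fin leNgt e0.
  apply: cvge_ge h; apply: nearW => n /=; rewrite leNgt; apply/negP; exact: nlt.
exists N => -[|M]; first by exists point; rewrite mulr0.
exact: (rare_visits mu1 muf _ (BM N) muN).
Qed.

Lemma chimax_of_not_slow (mu : {measure set (borelX d) -> \bar R}) b :
  ergodic_prob f mu ->
  (forall e : R, 0 < e -> exists C : R, forall n x, growth f A n x <= (b + e) * n%:R + C) ->
  (forall c, c < b -> mu (slow_limit f A c) = 0%E) ->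
  chimax_mu A f mu = b.
Proof.
move=> muE up mu0; apply: chimax_of_ae => //.
apply: (negligibleS
    (A := \bigcup_k (slow_limit f A (b - k.+1%:R^-1) : set (borelX d)))).
  move=> x; apply: contra_notP => nslow.
  apply: rate_cvg => e e0; first by have [C CP] := up e e0; exists C => n; exact: CP.
  have [k ke] : exists k : nat, k.+1%:R^-1 < e.
    exists (Num.bound e^-1); rewrite invf_plt ?posrE //.
    by rewrite (@lt_trans _ _ (Num.bound e^-1)%:R) ?ltr_nat // archi_boundP // invr_ge0 ltW.
  have [|C CP] := @not_slow_limit R X f m A (b - k.+1%:R^-1) x.
    by move=> xs; apply: nslow; exists k.
  exists C%:R => n; rewrite (le_trans _ (CP n)) // lerD2r ler_wpM2r //.
  by rewrite lerD2l lerN2 ltW.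
apply: negligible_bigcup => k; exists (slow_limit f A (b - k.+1%:R^-1)); split=> //.
  exact: (measurable_slow_limit dM fC Au alpha_gt0 AH AK AVK).
by apply: mu0; rewrite gtrBl invr_gt0.
Qed.

Lemma gap_often_slow b :
  (forall e : R, 0 < e -> exists C : R, forall n x, growth f A n x <= (b + e) * n%:R + C) ->
  (ereal_inf (ergodic_exponents d A f) < ereal_sup (ergodic_exponents d A f))%E ->
  exists2 c, c < b & often_slow f A c.
Proof.
move=> up gap; apply: contrapT => none; move: gap; apply/negP; rewrite -leNgt.
apply: (constant_exponents_no_gap (b := b)) => mu muE.
apply: chimax_of_not_slow => // c cb.
have [mu1 muf erg] := muE.
have [] // := erg (slow_limit f A c).
- exact: (measurable_slow_limit dM fC Au alpha_gt0 AH AK AVK).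
- exact: (slow_limit_invariant f Au AK AVK).
by move=> muD; exfalso; apply: none; exists c => //; exact: (often_slow_of_measure muE).
Qed.

End SlowDichotomy.

(** * Shadowing *)

Section Shadowing.
Variables (R : realType) (X : pointedType) (d : X -> X -> R) (f : X -> X).
Hypotheses (dM : is_metric d) (dC : mcompact d) (fC : mcontinuous d f).

Let dge0 x y : 0 <= d x y. Proof. by case: dM. Qed.
Let dsym x y : d x y = d y x. Proof. by case: dM. Qed.
Let dtri x y z : d x z <= d x y + d y z. Proof. by case: dM. Qed.

Lemma bowen_ball_le x (del del' lam : R) n z : del <= del' ->
  bowen_ball d f x del lam n z -> bowen_ball d f x del' lam n z.
Proof.
move=> dd xz i /xz h; rewrite (lt_le_trans h) //.
by rewrite ler_wpM2r ?expR_ge0.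
Qed.

Lemma bowen_ball_dist x (del lam : R) n z i : 0 < lam -> 0 < del ->
  bowen_ball d f x del lam n z -> (i <= n)%N -> d (iter i f x) (iter i f z) < del.
Proof.
move=> lam0 del0 xz /xz h; rewrite (lt_le_trans h) // ler_piMr ?(ltW del0) //.
by rewrite -expR0 ler_expR mulNr oppr_le0 mulr_ge0 // ltW.
Qed.

Lemma exp_specification_infinite : exp_specification d f ->
  exists2 lam : R, 0 < lam & forall del : R, 0 < del -> exists N : nat,
  forall (xs : nat -> X) (Ns Ms : nat -> nat),
    Ns 0%N = 0%N -> (forall j, (Ns j + Ms j + N <= Ns j.+1)%N) ->
    exists y, forall i, bowen_ball d f (xs i) del lam (Ms i) (iter (Ns i) f y).
Proof.
move=> [lam lam0 spec]; exists lam => // del del0.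
have [|N _ NP] := spec (del / 2); first by rewrite divr_gt0.
exists N => xs Ns Ms N0 Nstep.
have [k|u uP] := @choice nat X (fun k y => forall i, (i < k.+1)%N ->
    bowen_ball d f (xs i) (del / 2) lam (Ms i) (iter (Ns i) f y)).
  by apply: NP => // -[|j] //= _; exact: Nstep.
have [y yP] := sequence_cluster dM dC u; exists y => i t tM.
set E := expR _; have E0 : 0 < del / 2 * E by rewrite mulr_gt0 ?divr_gt0 ?expR_gt0.
have [r r0 rP] := mcontinuous_iter fC (t + Ns i) y E0.
have [k ik /rP yk] := yP r i r0.
have xk := uP k i (leq_ltn_trans ik (ltnSn k)) t tM.
rewrite -!iterD in xk *; rewrite (le_lt_trans (dtri _ (iter (t + Ns i) f (u k)) _)) //.
rewrite (splitr del) mulrDl ltrD //.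
by rewrite dsym.
Qed.

Lemma uniform_iter N (e : R) : 0 < e -> exists2 r : R, 0 < r & forall n,
  (n <= N)%N -> forall x y, d x y < r -> d (iter n f x) (iter n f y) < e.
Proof.
move=> e0; apply: common_radius => [n r s rs sP x y xy|n].
  by apply: sP; exact: lt_le_trans rs.
apply: (continuous_uniform dM dC) => // x e' e'0; exact: mcontinuous_iter.
Qed.

Lemma distal_pair (p q : X) : exp_specification d f -> p <> q ->
  exists u v t0, 0 < t0 /\ forall i, t0 <= d (iter i f u) (iter i f v).
Proof.
move=> /exp_specification_infinite[lam lam0 spec] pq.
have pq0 : 0 < d p q.
  by rewrite lt_def dge0 andbT; apply/eqP; case: dM => _ h _ _ /h.
have [|N NP] := spec (d p q / 4); first by rewrite divr_gt0.
have orb x : exists y, forall j, d x (iter (j * N.+1) f y) < d p q / 4.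
  have [//|j|y yP] := NP (fun=> x) (fun j => j * N.+1)%N (fun=> 0%N).
    by rewrite addn0 mulSn addnC leq_add2r.
  by exists y => j; have := yP j 0%N isT; rewrite min0n mulr0 expR0 mulr1.
have [u uP] := orb p; have [v vP] := orb q.
have [|t0 t00 t0P] := @uniform_iter N.+1 (d p q / 2); first by rewrite divr_gt0.
exists u, v, t0; split=> // i; rewrite leNgt; apply/negP => close.
pose n := ((i %/ N.+1).+1 * N.+1 - i)%N.
have ni : (n + i = (i %/ N.+1).+1 * N.+1)%N.
  by rewrite subnK // ltnW // ltn_ceil.
have nN : (n <= N.+1)%N by rewrite leq_subLR mulSn addnC leq_add2r leq_divM.
have := t0P _ nN _ _ close; rewrite -!iterD ni.
have := uP (i %/ N.+1).+1; have := vP (i %/ N.+1).+1.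
set a := iter _ f u; set b := iter _ f v => qb pa ab.
have h1 := dtri p a q; have h2 := dtri a b q; rewrite (dsym b q) in h2.
by move: qb pa ab h1 h2 pq0; lra.
Qed.

End Shadowing.

(** * Sparse concatenations of segments *)

Section Frequencies.
Variable R : realType.

Lemma limn_sup_eq (u : nat -> R) (l : R) : (forall n, u n <= l) ->
  (forall (e : R) L, 0 < e -> exists2 n, (L <= n)%N & l - e <= u n) ->
  limn_sup u = l.
Proof.
move=> ul often; rewrite /limn_sup (_ : sups u = fun=> l); last first.
  apply/funext => L; apply/eqP; rewrite eq_le; apply/andP; split.
    by apply: ge_sup => [|_ [n _ <-] //]; exists (u L), L => /=.
  apply/ler_addgt0Pr => e e0; have [n Ln un] := often e L e0.
  rewrite -lerBlDr (le_trans un) //; apply: ub_le_sup; last by exists n.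
  by exists l => _ [k _ <-].
exact: lim_cst.
Qed.

Lemma limn_inf_eq (u : nat -> R) (l : R) : (forall n, l <= u n) ->
  (forall (e : R) L, 0 < e -> exists2 n, (L <= n)%N & u n <= l + e) ->
  limn_inf u = l.
Proof.
move=> lu often; rewrite /limn_inf (_ : infs u = fun=> l); last first.
  apply/funext => L; apply/eqP; rewrite eq_le; apply/andP; split.
    apply/ler_addgt0Pr => e e0; have [n Ln un] := often e L e0.
    apply: le_trans un; apply: ge_inf; last by exists n.
    by exists l => _ [k _ <-].
  by apply: lb_le_inf => [|_ [n _ <-] //]; exists (u L), L => /=.
exact: lim_cst.
Qed.

Lemma count_iota_all (P : pred nat) a l :
  (forall i, (a <= i < a + l)%N -> P i) -> count P (iota a l) = l.
Proof.
move=> aP; rewrite -[RHS](size_iota a l); apply/eqP; rewrite -all_count.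
by apply/allP => i; rewrite mem_iota; exact: aP.
Qed.

Variables (X : pointedType) (d : X -> X -> R) (f : X -> X).
Implicit Types x y : X.

Lemma close_freq_ge0 x y (t : R) n : 0 <= close_freq d f x y t n.
Proof. by rewrite divr_ge0. Qed.

Lemma close_freq_le1 x y (t : R) n : close_freq d f x y t n <= 1.
Proof.
case: n => [|n]; first by rewrite /close_freq invr0 mulr0.
by rewrite ler_pdivrMr ?ltr0n // mul1r ler_nat (leq_trans (count_size _ _)) ?size_iota.
Qed.

Lemma inv_small (e D : R) : 0 < e -> exists L, forall j, (L <= j)%N -> D / j.+1%:R <= e.
Proof.
move=> e0; exists (Num.bound (`|D| / e)) => j Lj.
rewrite ler_pdivrMr ?ltr0n // (le_trans (ler_norm _)) // mulrC -ler_pdivrMr //.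
by rewrite ltW // (lt_le_trans (archi_boundP _)) ?divr_ge0 ?(ltW e0) // ler_nat ltnW.
Qed.

Variables Ns Ms : nat -> nat.
Hypothesis long : forall j, (j.+1 * (Ns j).+1 <= Ms j)%N.

Lemma sparse_start j : (Ns j).+1%:R <= (Ns j + Ms j)%:R / j.+1%:R :> R.
Proof.
by rewrite ler_pdivlMr ?ltr0n // -natrM ler_nat mulnC (leq_trans (long j)) ?leq_addl.
Qed.

Let end_ge j : (j < Ns j + Ms j)%N.
Proof.
by rewrite ltn_addl // (leq_trans _ (long j)) // leq_pmulr.
Qed.

Lemma close_freq_limsup x y (t : R) (I0 : nat) :
  (forall L, exists2 j, (L <= j)%N & forall i, (I0 <= i)%N -> (i + I0 <= Ms j)%N ->
     d (iter (Ns j + i) f x) (iter (Ns j + i) f y) < t) ->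
  limn_sup (close_freq d f x y t) = 1.
Proof.
move=> often; apply: limn_sup_eq => [n|e L e0]; first exact: close_freq_le1.
have [L' L'P] := @inv_small e (2 * I0).+1%:R e0.
have [j jL jP] := often (maxn (2 * I0) (maxn L L')).
move: jL; rewrite !geq_max => /and3P[jI jL jL'].
exists (Ns j + Ms j)%N; first by rewrite (leq_trans jL) // ltnW // end_ge.
have n0 : 0 < (Ns j + Ms j)%:R :> R by rewrite ltr0n (leq_ltn_trans _ (end_ge j)).
have IM : (2 * I0 <= Ms j)%N.
  by rewrite (leq_trans jI) // (leq_trans (leqnSn j)) // (leq_trans _ (long j)) // leq_pmulr.
rewrite /close_freq ler_pdivlMr //.
set P := fun i => _.
have cnt : (Ms j - 2 * I0 <= count P (iota 0 (Ns j + Ms j)))%N.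
  have -> : (Ns j + Ms j = (Ns j + I0) + ((Ms j - 2 * I0) + I0))%N by lia.
  rewrite (iotaD 0 (Ns j + I0)) count_cat add0n (iotaD (Ns j + I0)) count_cat.
  rewrite [X in (_ + (X + _))%N]count_iota_all ?(addnCA _ (Ms j - _)%N) ?leq_addr //.
  move=> i /andP[i1 i2]; rewrite /P -(subnKC (leq_trans (leq_addr I0 _) i1)).
  by apply: jP; lia.
have cntR : (Ms j)%:R - (2 * I0)%:R <= (count P (iota 0 (Ns j + Ms j)))%:R :> R.
  by rewrite -natrB // ler_nat.
apply: le_trans cntR.
have small := L'P _ jL'; have start := sparse_start j.
have h : (Ns j + 2 * I0)%:R <= e * (Ns j + Ms j)%:R.
  apply: (@le_trans _ _ ((2 * I0).+1%:R / j.+1%:R * (Ns j + Ms j)%:R)); last first.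
    by rewrite ler_wpM2r.
  rewrite mulrAC -mulrA; apply: le_trans (ler_wpM2l (ler0n _ _) start).
  by rewrite -natrM ler_nat; nia.
by move: h; rewrite !natrD; lra.
Qed.

Lemma close_freq_liminf x y (t : R) :
  (forall L, exists2 j, (L <= j)%N & forall i, (i <= Ms j)%N ->
     t <= d (iter (Ns j + i) f x) (iter (Ns j + i) f y)) ->
  limn_inf (close_freq d f x y t) = 0.
Proof.
move=> often; apply: limn_inf_eq => [n|e L e0]; first exact: close_freq_ge0.
have [L' L'P] := @inv_small e 1 e0.
have [j jL jP] := often (maxn L L').
move: jL; rewrite !geq_max => /andP[jL jL'].
exists (Ns j + Ms j)%N; first by rewrite (leq_trans jL) // ltnW // end_ge.
have n0 : 0 < (Ns j + Ms j)%:R :> R by rewrite ltr0n (leq_ltn_trans _ (end_ge j)).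
rewrite add0r /close_freq ler_pdivrMr //.
set P := fun i => _.
have cnt : (count P (iota 0 (Ns j + Ms j)) <= (Ns j).+1)%N.
  rewrite iotaD count_cat add0n [X in (_ + X)%N](_ : _ = 0%N).
    by rewrite addn0 (leq_trans (count_size _ _)) // size_iota.
  apply/eqP; rewrite -leqn0 leqNgt -has_count; apply/hasPn => i.
  rewrite mem_iota => /andP[i1 i2]; rewrite /P -leNgt -(subnKC i1).
  by apply: jP; lia.
apply: (@le_trans _ _ (Ns j).+1%:R); first by rewrite ler_nat.
apply: (le_trans (sparse_start j)); rewrite mulrC ler_wpM2r //.
by have := L'P _ jL'; rewrite mul1r.
Qed.

Lemma sparse_dominated (p D : R) :
  (forall L, exists2 j, (L <= j)%N & p * (Ms j)%:R <= D * (Ns j).+1%:R) -> p <= 0.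
Proof.
move=> often; rewrite leNgt; apply/negP => p0.
have [L LP] := @inv_small p (D + 1) p0; have [j Lj jP] := often L.
have := LP j Lj; rewrite ler_pdivrMr ?ltr0n // => Dp.
have : p * (j.+1 * (Ns j).+1)%:R <= D * (Ns j).+1%:R.
  by apply: le_trans jP; rewrite ler_pM2l // ler_nat.
rewrite natrM mulrA ler_pM2r ?ltr0n // => h.
by have := le_trans Dp h; rewrite gerDl ler10.
Qed.

End Frequencies.

Section Irregularity.
Variables (R : realType) (X : pointedType) (f : X -> X).
Variables (m : nat) (A : X -> 'M[R]_m.+1) (K : R).
Hypothesis Au : forall x, A x \in unitmx.
Hypotheses (K_gt0 : 0 < K) (AK : forall x, opnorm (A x) <= expR K).
Hypothesis AVK : forall x, opnorm (invmx (A x)) <= expR K.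
Variables Ns Ms : nat -> nat.
Hypothesis long : forall j, (j.+1 * (Ns j).+1 <= Ms j)%N.

Lemma MLI_of_alternation (b c C : R) y : c < b -> 0 <= C ->
  (forall L, exists2 j, (L <= j)%N &
     b * (Ms j)%:R - C <= growth f A (Ms j) (iter (Ns j) f y)) ->
  (forall L, exists2 j, (L <= j)%N &
     growth f A (Ms j) (iter (Ns j) f y) <= c * (Ms j)%:R + C) ->
  MLI A f y.
Proof.
move=> cb C0 fast slow /cvg_ex[/= l lyap_l].
pose e := (b - c) / 4; have e0 : 0 < e by rewrite divr_gt0 ?subr_gt0.
have [L LP] : exists L, forall j, (L <= j)%N ->
    `|l - (Ns j + Ms j)%:R^-1 * growth f A (Ns j + Ms j) y| < e.
  have /cvgrPdist_lt/(_ e e0)[L _ LP] := lyap_l; exists L => j Lj; apply: LP => /=.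
  by rewrite (leq_trans Lj) // (leq_trans _ (leq_addl _ _)) // (leq_trans (leqnSn j)) //
    (leq_trans _ (long j)) // leq_pmulr.
pose D := C + K + `|l + e| + `|l - e|.
have n0 j : 0 < (Ns j + Ms j)%:R :> R.
  by rewrite ltr0n addn_gt0 (leq_trans _ (long j)) ?orbT.
have close j : (L <= j)%N ->
    (l - e) * (Ns j + Ms j)%:R <= growth f A (Ns j + Ms j) y <= (l + e) * (Ns j + Ms j)%:R.
  move/LP; rewrite ltr_distlC mulrC ltr_pdivlMr // ltr_pdivrMr // => /andP[h1 h2].
  by rewrite !ltW.
have bounds j : C <= C * (Ns j).+1%:R /\ K * (Ns j)%:R <= K * (Ns j).+1%:R /\
    (l + e) * (Ns j)%:R <= `|l + e| * (Ns j).+1%:R /\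
    - ((l - e) * (Ns j)%:R) <= `|l - e| * (Ns j).+1%:R.
  have nS : (Ns j)%:R <= (Ns j).+1%:R :> R by rewrite ler_nat.
  have absle (r : R) : r * (Ns j)%:R <= `|r| * (Ns j).+1%:R.
    by rewrite (le_trans (ler_wpM2r _ (ler_norm r))) // ler_wpM2l.
  split; first by rewrite ler_peMr // ler1n.
  split; first by rewrite ler_wpM2l // ltW.
  by split; rewrite // -mulNr (le_trans (absle _)) // normrN.
have h1 : b - (l + e) <= 0.
  apply: (sparse_dominated (D := D) long) => L'; have [j] := fast (maxn L L').
  rewrite geq_max => /andP[Lj L'j] jP; exists j => //.
  have /andP[_ up] := close j Lj; rewrite natrD in up.
  have := growth_iter_le f Au AVK (Ns j) (Ms j) y.
  have [b1 [b2 [b3 b4]]] := bounds j; rewrite /D !mulrDl.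
  have : 0 <= `|l - e| * (Ns j).+1%:R by rewrite mulr_ge0.
  by move: jP up b1 b2 b3 b4; rewrite !mulrDr; lra.
have h2 : (l - e) - c <= 0.
  apply: (sparse_dominated (D := D) long) => L'; have [j] := slow (maxn L L').
  rewrite geq_max => /andP[Lj L'j] jP; exists j => //.
  have /andP[lo _] := close j Lj; rewrite natrD in lo.
  have := growthD f Au (Ns j) (Ms j) y.
  have := growth_le f Au AK (Ns j) y.
  have [b1 [b2 [b3 b4]]] := bounds j; rewrite /D !mulrDl.
  have : 0 <= `|l + e| * (Ns j).+1%:R by rewrite mulr_ge0.
  by move: jP lo b1 b2 b3 b4; rewrite !mulrDr; lra.
by move: h1 h2 cb; rewrite /e; lra.
Qed.

End Irregularity.

Lemma range_cantor_uncountable (T : choiceType) (g : (nat -> bool) -> T) :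
  injective g -> ~ countable (range g).
Proof.
move=> ginj /countable_injP[h hinj].
have hg w w' : h (g w) = h (g w') -> w = w'.
  by move=> hh; apply: ginj; apply: hinj hh; rewrite inE; [exists w|exists w'].
pose w n := `[< exists w', h (g w') = n /\ ~~ w' n >].
have [wn|wn] := boolP (w (h (g w))).
  by have /asboolP[w' [/hg ->]] := wn; rewrite wn.
by move: (wn) => /asboolP; apply; exists w.
Qed.

Lemma bowen_ball_close (R : realType) (X : pointedType) (d : X -> X -> R)
    (f : X -> X) (lam del t : R) : is_metric d -> 0 < lam -> 0 < del -> 0 < t ->
  exists I0 : nat, forall x M z z',
    bowen_ball d f x del lam M z -> bowen_ball d f x del lam M z' ->
    forall i, (I0 <= i)%N -> (i + I0 <= M)%N -> d (iter i f z) (iter i f z') < t.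
Proof.
move=> [_ _ dsym dtri] lam0 del0 t0.
exists (Num.bound (2 * del / t / lam)) => x M z z' xz xz' i I0i iM.
set I0 := Num.bound _ in I0i iM.
have iM' : (i <= M)%N by rewrite (leq_trans _ iM) ?leq_addr.
apply: (le_lt_trans (dtri _ (iter i f x) _)); rewrite dsym.
apply: (lt_trans (ltrD (xz i iM') (xz' i iM'))).
rewrite -[ltLHS]mulr2n -[ltLHS]mulr_natl mulrA mulNr expRN.
rewrite ltr_pdivrMr ?expR_gt0 // [ltRHS]mulrC -ltr_pdivrMr //.
apply: (@lt_le_trans _ _ (1 + lam * I0%:R)); last first.
  rewrite (le_trans (expR_ge1Dx _)) // ler_expR ler_pM2l // ler_nat leq_min I0i /=.
  by rewrite leq_subRL // addnC.
rewrite ltr_wpDl // [ltRHS]mulrC -ltr_pdivrMr // archi_boundP //.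
by rewrite !divr_ge0 ?mulr_ge0 // ltW.
Qed.

Fixpoint segment_start (len : nat -> nat -> nat) (N j : nat) : nat :=
  if j is i.+1 then
    segment_start len N i + len i (segment_start len N i) + N
  else 0.

Lemma subsingleton_no_gap (R : realType) (X : pointedType) (f : X -> X) m
    (A : X -> 'M[R]_m.+1) (b c C : R) :
  (forall p q : X, p = q) -> c < b ->
  (forall N, exists2 n, (N <= n)%N & exists x, b * n%:R - 2 <= growth f A n x) ->
  (forall n, exists x, growth f A n x <= c * n%:R + C) -> False.
Proof.
move=> one cb fast slow.
have bc : 0 < b - c by rewrite subr_gt0.
have [L LP] := inv_small (`|C + 2| + 1) bc.
have [[|n] Ln [x xn]] := fast L.+1; first by rewrite ltn0 in Ln.
have [y yn] := slow n.+1; rewrite (one y x) in yn.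
have := LP n Ln; rewrite ler_pdivrMr ?ltr0n //.
by move: xn yn (ler_norm (C + 2)); lra.
Qed.

Lemma far_of_far_orbits (R : realType) (X : pointedType) (d : X -> X -> R)
    (t del : R) (x x' z z' : X) : is_metric d -> del <= t / 4 ->
  t <= d x x' -> d x z < del -> d x' z' < del -> t / 2 <= d z z'.
Proof.
move=> [_ _ dsym dtri] delt xx' xz xz'.
have h1 := dtri x z x'; have h2 := dtri z z' x'; rewrite (dsym z' x') in h2.
by move: h1 h2 xx' xz xz' delt; lra.
Qed.

Lemma mod3_often r L : (r < 3)%N -> exists2 j, (L <= j)%N & (j %% 3 = r)%N.
Proof. by move=> r3; exists (L * 3 + r)%N; [lia|rewrite modnMDl modn_small]. Qed.

Lemma bit_reading_index n L : exists2 j, (L <= j)%N &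
  [/\ (3 %| j)%N = false, (3 %| j.+2)%N = false & logn 2 j.+1 = n].
Proof.
have [k kE] : exists k, k = (2 ^ n * 3 ^ L.+1)%N by exists (2 ^ n * 3 ^ L.+1)%N.
have k0 : (0 < k)%N by rewrite kE muln_gt0 !expn_gt0.
have k3 : (k %% 3 = 0)%N by rewrite kE expnS mulnCA modnMr.
have kP : k.-1.+1 = k by rewrite prednK.
exists k.-1; rewrite ?kP.
  rewrite -ltnS kP kE.
  by apply: leq_trans (leq_pmull _ _); rewrite ?expn_gt0 // ltnW // ltn_expl.
split.
- by clear kE; apply/negP; rewrite /dvdn => /eqP; lia.
- by clear kE; apply/negP; rewrite /dvdn => /eqP; lia.
by rewrite kE lognM ?expn_gt0 // pfactorK // logn_coprime ?coprimeXr // addn0.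
Qed.


Section ScrambledSet.
Variables (R : realType) (X : pointedType) (d : X -> X -> R) (f : X -> X).
Variables (m : nat) (A : X -> 'M[R]_m.+1) (alpha : R).
Hypotheses (dM : is_metric d) (dC : mcompact d) (fC : mcontinuous d f).
Hypotheses (Au : forall x, A x \in unitmx) (alpha_gt0 : 0 < alpha).
Hypotheses (AH : holder d A alpha) (spec : exp_specification d f).

(* Segment [j] of the orbit of [Y w] shadows a fast, a slow, or one of the two
   distal orbits according to [j] modulo 3; the bit [w n] is read at the [j = 2]
   modulo 3 for which [n] is the exponent of 2 in [j + 1], hence infinitely often. *)
Lemma irregular_scrambled_set :
  (ereal_inf (ergodic_exponents d A f) < ereal_sup (ergodic_exponents d A f))%E ->
  exists S : set X, [/\ S `<=` MLI A f, ~ countable S & DC1_scrambled d f S].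
Proof.
move=> gap.
have [K K0 AKV] := opnorm_generator_bound dM dC Au alpha_gt0 AH.
have AK x : opnorm (A x) <= expR K by case: (AKV x).
have AVK x : opnorm (invmx (A x)) <= expR K by case: (AKV x).
have [b [bmax maxb]] := subadditive_rate (max_growth_norm f Au AK AVK)
  (max_growthD f Au AK).
have up (e : R) : 0 < e -> exists C : R, forall n x, growth f A n x <= (b + e) * n%:R + C.
  move=> /maxb[C _ CP]; exists C => n x; rewrite (le_trans _ (CP n)) //.
  exact: growth_le_max.
have [c cb slow] := gap_often_slow dM fC Au alpha_gt0 AH AK AVK up gap.
have [c' cc' c'b] : exists2 c', c < c' & c' < b by exists ((c + b) / 2); rewrite midf_lt.
have [eta [C [eta0 slowP]]] := slow_segments dM dC fC Au alpha_gt0 AH AK AVK slow cc'.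
have [lam lam0 specP] := exp_specification_infinite dM dC fC spec.
have [del1 del10 fastP] := fast_segments dM Au alpha_gt0 AH AK lam0 bmax maxb.
have [p [q pq]] : exists p q : X, p <> q.
  apply: contrapT => /forallNP one.
  have one' (p q : X) : p = q by apply: contrapT => pq; apply: (one p); exists q.
  apply: (subsingleton_no_gap one' c'b (C := C) (f := f) (A := A)).
    move=> N; have [n Nn [x xP]] := fastP N; exists n => //; exists x; apply: xP => i _.
    by rewrite metric_refl // mulr_gt0 ?expR_gt0.
  move=> n; have [x xP] := slowP n; exists x; apply: xP => i _.
  by rewrite metric_refl.
have [u [v [t0 [t00 uvt]]]] := distal_pair dM dC fC spec pq.
pose del := Num.min del1 (Num.min eta (t0 / 4)).
have del0 : 0 < del by rewrite !lt_min del10 eta0 divr_gt0.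
have del_del1 : del <= del1 by rewrite ge_min lexx.
have del_eta : del <= eta by rewrite !ge_min lexx orbT.
have del_t0 : del <= t0 / 4 by rewrite !ge_min lexx !orbT.
have [N NP] := specP _ del0.
have [fl flP] := @choice nat (nat * X) (fun L r => (L <= r.1)%N /\ forall z,
    bowen_ball d f r.2 del1 lam r.1 z -> b * r.1%:R - 2 <= growth f A r.1 z)
  (fun L => let: ex_intro2 n Ln (ex_intro x xP) := fastP L in
     ex_intro _ (n, x) (conj Ln xP)).
have [sl slP] := choice slowP.
pose len j n := if (3 %| j)%N then (fl (j.+1 * n.+1)%N).1 else (j.+1 * n.+1)%N.
pose Ns := segment_start len N; pose Ms j := len j (Ns j).
pose xs (w : nat -> bool) j := if (3 %| j)%N then (fl (j.+1 * (Ns j).+1)%N).2 else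
  if (3 %| j.+2)%N then sl (Ms j) else if w (logn 2 j.+1) then u else v.
have long j : (j.+1 * (Ns j).+1 <= Ms j)%N.
  by rewrite /Ms /len; case: ifP => // _; case: (flP (j.+1 * (Ns j).+1)%N).
have shadow w : exists y, forall j,
    bowen_ball d f (xs w j) del lam (Ms j) (iter (Ns j) f y).
  by apply: NP => // j; rewrite /Ns /Ms /= leqnn.
have [Y YP] := choice shadow.
have dsym x y : d x y = d y x by case: dM.
have apart w w' n : w n != w' n -> forall L, exists2 j, (L <= j)%N & forall i, (i <= Ms j)%N ->
    t0 / 2 <= d (iter (Ns j + i) f (Y w)) (iter (Ns j + i) f (Y w')).
  move=> ww' L; have [j Lj [j0 j1 jn]] := bit_reading_index n L; exists j => //.
  have xE w0 : xs w0 j = if w0 n then u else v by rewrite /xs j0 j1 jn.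
  move=> i iM; rewrite addnC !iterD.
  have := bowen_ball_dist lam0 del0 (YP w j) iM.
  have := bowen_ball_dist lam0 del0 (YP w' j) iM.
  rewrite !xE; move: ww'; case: (w n) (w' n) => [] [] // _ h' h;
    apply: (far_of_far_orbits dM del_t0 _ h h') => //.
  by rewrite dsym.
exists (range Y); split.
- move=> _ [w _ <-].
  apply: (MLI_of_alternation Au K0 AK AVK long (b := b) (c := c') (C := Num.max 2 C)) => //.
  + by rewrite le_max ler0n.
  + move=> L; have [j Lj j0] := @mod3_often 0 L isT; exists j => //.
    have j3 : (3 %| j)%N by rewrite /dvdn j0.
    have := YP w j; rewrite /xs /Ms /len j3 => /(bowen_ball_le del_del1).
    move/((flP _).2); apply: le_trans.
    by rewrite lerD2l lerN2 le_max lexx.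
  + move=> L; have [j Lj j1] := @mod3_often 1 L isT; exists j => //.
    have j3 : (3 %| j)%N = false by rewrite /dvdn j1.
    have j3' : (3 %| j.+2)%N by rewrite /dvdn -addn2 -modnDml j1.
    have := YP w j; rewrite /xs j3 j3' => h.
    apply: (@le_trans _ _ (c' * (Ms j)%:R + C)).
      apply: slP => i iM; apply: lt_le_trans del_eta.
      exact: bowen_ball_dist h (ltnW iM).
    by rewrite lerD2l le_max lexx orbT.
- apply: range_cantor_uncountable => w w' Yww'; apply/funext => n.
  apply/eqP; apply: contraT => ww'.
  have [j _ /(_ 0%N isT)] := apart w w' n ww' 0%N.
  by rewrite Yww' metric_refl // leNgt divr_gt0.
move=> _ _ [w _ <-] [w' _ <-] Yww'; split=> [t t_gt0|].
  have [I0 I0P] := bowen_ball_close f dM lam0 del0 t_gt0.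
  apply: (close_freq_limsup long (I0 := I0)) => L.
  have [j Lj j0] := @mod3_often 0 L isT; exists j => // i iI iM.
  have j3 : (3 %| j)%N by rewrite /dvdn j0.
  have := YP w j; have := YP w' j; rewrite /xs j3 => h' h.
  by rewrite addnC !iterD; exact: I0P h h' i iI iM.
have [n ww'] : exists n, w n != w' n.
  apply: contrapT => /forallNP same; apply: Yww'; congr Y; apply/funext => n.
  by apply/eqP; apply: contraT => /same.
exists (t0 / 2); first by rewrite divr_gt0.
exact: (close_freq_liminf long (apart w w' n ww')).
Qed.

End ScrambledSet.

Unset Implicit Arguments.

Theorem theorem4p1 (R : realType) (X : pointedType) (d : X -> X -> R)
  (f : X -> X) (m : nat) (A : X -> 'M[R]_m) (alpha : R) :
  is_metric d -> mcompact d -> mcontinuous d f -> exp_specification d f ->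
  (forall x, A x \in unitmx) -> 0 < alpha -> holder d A alpha ->
  (ereal_inf (ergodic_exponents d A f) < ereal_sup (ergodic_exponents d A f))%E ->
  exists S : set X,
    [/\ S `<=` MLI A f, ~ countable S & DC1_scrambled d f S].
Proof.
move=> dM dC fC spec; case: m A => [|m] A Au alpha0 AH gap.
  exfalso; move: gap; apply/negP; rewrite -leNgt.
  apply: (constant_exponents_no_gap (b := 0)) => mu muE; apply: chimax_of_ae => //.
  apply: aeW => x; rewrite (_ : lyap_seq A f x = fun=> 0); first exact: cvg_cst.
  by apply/funext => n; rewrite /lyap_seq opnorm_size0 ln0 // mulr0.
exact: (irregular_scrambled_set dM dC fC Au alpha0 AH spec gap).
Qed.
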